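(* Let $F$ be a field of characteristic $p\ne 0$, let $\mathfrak F$ be a saturated formation of soluble Lie algebras over $F$, and let $S\in\mathfrak F$. Let $(L,[p])$ be a (finite dimensional) $p$-envelope of $S$ and suppose that $z^{[p]}=0$ for all $z$ in the centre of $L$. Let $V,W$ be irreducible (finite dimensional) $S$-modules. Suppose that $\mathrm{Cl}(V)=\mathrm{Cl}(W)$. Then $V,W$ are either both $\mathfrak F$-central or both $\mathfrak F$-eccentric.
   Context: All Lie algebras and modules are finite dimensional. Formations. A formation of soluble Lie algebras over $F$ is a class $\mathfrak F$ of finite dimensional soluble Lie algebras over $F$, closed under isomorphism, closed under quotients, and such that if $A,B$ are ideals of $K$ with $K/A,K/B\in\mathfrak F$ then $K/(A\cap B)\in\mathfrak F$. It is saturated if, for every soluble $K$, $K/\Phi(K)\in\mathfrak F$ implies $K\in\mathfrak F$, where $\Phi(K)$ is the Frattini subalgebra (the intersection of the maximal subalgebras of $K$, which is an ideal for soluble $K$). For a soluble Lie algebra $S$, an irreducible $S$-module $V$ is called $\mathfrak F$-central if the split extension (semidirect sum) of $V$ (as abelian ideal) by $S/C_S(V)$ is in $\mathfrak F$, where $C_S(V)=\{s\in S\mid sV=0\}$; otherwise $V$ is called $\mathfrak F$-eccentric. $p$-envelopes. A $p$-envelope of $S$ is a restricted Lie algebra $(L,[p])$ containing $S$ as a Lie subalgebra such that the smallest subalgebra of $L$ containing $S$ and closed under $x\mapsto x^{[p]}$ is $L$. The action of $S$ on an $S$-module can be extended to an action $\rho$ of $L$; clusters of $S$-modules are computed by regarding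 them as $L$-modules by such an extension. Clusters. Let $\bar F$ be the algebraic closure of $F$, $\bar L=\bar F\otimes_F L$ and, for an $L$-module $V$, $\bar V=\bar F\otimes_F V$. A character of $L$ is an $F$-linear map $c:L\to\bar F$; an $\bar L$-module $M$ has character $c$ if $(\rho(x)^p-\rho(x^{[p]}))v=c(x)^pv$ for all $x\in L$, $v\in M$. Every irreducible finite dimensional $\bar L$-module has a unique character. The cluster $\mathrm{Cl}(V)$ is the set of characters of the composition factors of the $\bar L$-module $\bar V$. *)

(* Defs.v *)
From HB Require Import structures.
From mathcomp Require Import all_boot all_order all_algebra.
From mathcomp Require Import classical_sets.

Set Implicit Arguments.
Unset Strict Implicit.
Unset Printing Implicit Defensive.

Import GRing.Theory.
Local Open Scope ring_scope.

HB.mixin Record isLie (F : fieldType) L of Vector F L := {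
  lie : L -> L -> L;
  lie_linearl : forall y, linear (lie^~ y);
  lie_linearr : forall x, linear (lie x);
  liexx : forall x, lie x x = 0;
  lie_jacobi : forall x y z,
    lie x (lie y z) + lie y (lie z x) + lie z (lie x y) = 0
}.

#[short(type="lieType")]
HB.structure Definition Lie (F : fieldType) := {L of isLie F L & Vector F L}.

Section LieTheory.
Variables (F : fieldType) (L : lieType F).
Implicit Types x y z : L.

HB.instance Definition _ x :=
  GRing.isLinear.Build F L L *:%R (lie x) (lie_linearr x).

Lemma lieDl x y z : lie (x + y) z = lie x z + lie y z.
Proof. by have := lie_linearl z 1 x y; rewrite !scale1r. Qed.
Lemma lieDr x y z : lie z (x + y) = lie z x + lie z y.
Proof. exact: linearD. Qed.
Lemma lie0l x : lie 0 x = 0.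
Proof. by apply: (addrI (lie 0 x)); rewrite -lieDl !addr0. Qed.
Lemma lieZl a x z : lie (a *: x) z = a *: lie x z.
Proof. by have := lie_linearl z a x 0; rewrite !addr0 lie0l addr0. Qed.
Lemma lieNl x z : lie (- x) z = - lie x z.
Proof. by rewrite -scaleN1r lieZl scaleN1r. Qed.
Lemma lieBl x y z : lie (x - y) z = lie x z - lie y z.
Proof. by rewrite lieDl lieNl. Qed.
Lemma lieC x y : lie x y = - lie y x.
Proof.
apply/eqP; rewrite -addr_eq0; apply/eqP.
by have := liexx (x + y); rewrite lieDl !lieDr !liexx add0r addr0.
Qed.

Definition lieprod (U V : {vspace L}) : {vspace L} :=
  <<[seq lie x y | x <- vbasis U, y <- vbasis V]>>%VS.

Definition derived_series (n : nat) : {vspace L} :=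
  iter n (fun U => lieprod U U) fullv.

Definition soluble : Prop := exists n, derived_series n = 0%VS.

Definition subalgebra (U : {vspace L}) : Prop :=
  forall x y, x \in U -> y \in U -> lie x y \in U.

Definition maximal_subalgebra (M : {vspace L}) : Prop :=
  [/\ subalgebra M, M != fullv &
      forall U, subalgebra U -> (M <= U)%VS -> U = M \/ U = fullv].

Definition frattini : set L :=
  (\bigcap_(M in maximal_subalgebra) [set x | x \in M])%classic.

Definition center : set L := [set z | forall x, lie z x = 0]%classic.

Record ideal := Ideal {
  ideal_vs :> {vspace L};
  idealP : forall x a, a \in ideal_vs -> lie x a \in ideal_vs }.

Lemma ideal_cap_subproof (A B : ideal) x a :
  a \in (A :&: B)%VS -> lie x a \in (A :&: B)%VS.
Proof. by rewrite !memv_cap => /andP[aA aB]; rewrite !idealP. Qed.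

Definition ideal_cap (A B : ideal) : ideal := Ideal (@ideal_cap_subproof A B).

Lemma idealPl (A : ideal) x a : a \in A -> lie a x \in A.
Proof. by move=> aA; rewrite lieC rpredN idealP. Qed.

End LieTheory.
Arguments frattini {F} L.
Arguments center {F} L.
Arguments soluble {F} L.
Arguments ideal {F} L.

Definition lie_morphism (F : fieldType) (L M : lieType F) (f : 'Hom(L, M)) :=
  forall x y, f (lie x y) = lie (f x) (f y).

(* [facv B A] models B / A, for A <= B, by the complement [B :\: A] of A in B;
  [facpi B A] is the projection B -> B / A, which is onto with kernel A. *)

Section Factor.
Variables (F : fieldType) (V : vectType F) (B A : {vspace V}).

Definition facv : Type := subvs_of (B :\: A).
HB.instance Definition _ := Vector.on facv.

Definition facpi : 'Hom(V, facv) :=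
  (linfun (vsproj (B :\: A)) \o addv_pi1 B A)%VF.

Lemma facpiK (u : facv) : facpi (vsval u) = u.
Proof.
apply: val_inj; rewrite /= comp_lfunE lfunE /=.
rewrite vsprojK ?memv_pi //.
apply: daddv_pi_id; first exact: capv_diff.
exact: subvsP.
Qed.

Lemma facpi_kerP v : v \in B -> (facpi v == 0) = (v \in A).
Proof.
move=> vB.
have vBA : v \in (B + A)%VS by apply: subvP vB; exact: addvSl.
have e : vsval (facpi v) = addv_pi1 B A v.
  by rewrite /= comp_lfunE lfunE /= vsprojK ?memv_pi.
apply/eqP/idP => [v0|vA].
  have := addv_pi1_pi2 vBA; rewrite -e v0 linear0 add0r => <-.
  exact: memv_pi2.
apply: val_inj; rewrite /= e.
have /eqP := addv_pi1_pi2 vBA.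
by rewrite addv_pi2_id // -subr_eq0 addrK => /eqP.
Qed.

Lemma facpi_inB v : vsval (facpi v) \in B.
Proof. by apply: subvP (subvsP _); exact: diffvSl. Qed.

Lemma facpi_sub v : v \in (B + A)%VS -> v - vsval (facpi v) \in A.
Proof.
move=> vBA; rewrite /= comp_lfunE lfunE /= vsprojK ?memv_pi //.
by rewrite -{1}(addv_pi1_pi2 vBA) addrC addKr memv_pi2.
Qed.

End Factor.

Section Quotient.
Variables (F : fieldType) (K : lieType F) (A : ideal K).

Definition quotLie : Type := facv fullv A.
HB.instance Definition _ := Vector.on quotLie.

Definition quot_pi : 'Hom(K, quotLie) := facpi fullv A.

Definition quot_lie (u v : quotLie) : quotLie := quot_pi (lie (vsval u) (vsval v)).

Lemma quot_piK (u : quotLie) : quot_pi (vsval u) = u.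
Proof. exact: facpiK. Qed.

Lemma quot_pi_eq x y : x - y \in A -> quot_pi x = quot_pi y.
Proof.
move=> xyA; apply/eqP; rewrite -subr_eq0 -linearB /=.
by rewrite facpi_kerP ?memvf.
Qed.

Lemma quot_pi_sub x : x - vsval (quot_pi x) \in A.
Proof. by apply: facpi_sub; rewrite (subvP (addvSl _ _)) ?memvf. Qed.

Lemma quot_lieE x y : quot_lie (quot_pi x) (quot_pi y) = quot_pi (lie x y).
Proof.
apply/esym/quot_pi_eq.
set x' := vsval _; set y' := vsval _.
have [xA yA] : x - x' \in A /\ y - y' \in A by split; apply: quot_pi_sub.
have -> : lie x y - lie x' y' = lie (x - x') y + lie x' (y - y').
  by rewrite lieBl linearB /= addrA subrK.
by apply: memvD; [apply: idealPl | apply: idealP].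
Qed.

Lemma quot_lie_linearl y : linear (quot_lie^~ y).
Proof.
by move=> a u v; rewrite /quot_lie linearP lieDl lieZl linearP.
Qed.
Lemma quot_lie_linearr x : linear (quot_lie x).
Proof. by move=> a u v; rewrite /quot_lie !linearP. Qed.
Lemma quot_liexx x : quot_lie x x = 0.
Proof. by rewrite /quot_lie liexx linear0. Qed.
Lemma quot_lie_jacobi x y z :
  quot_lie x (quot_lie y z) + quot_lie y (quot_lie z x)
    + quot_lie z (quot_lie x y) = 0.
Proof.
rewrite -[x]quot_piK -[y]quot_piK -[z]quot_piK.
by rewrite !quot_lieE -!linearD /= lie_jacobi linear0.
Qed.

HB.instance Definition _ := isLie.Build F quotLie
  quot_lie_linearl quot_lie_linearr quot_liexx quot_lie_jacobi.

Lemma quot_pi_morphism : lie_morphism quot_pi.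
Proof. by move=> x y; rewrite /lie /= quot_lieE. Qed.

End Quotient.

Section Modules.
Variables (F : fieldType) (L : lieType F).

(* an L-module structure on V *)
Record lieRep (V : vectType F) := LieRep {
  lrep :> 'Hom(L, 'End(V));
  lrepP : forall x y v,
    lrep (lie x y) v = lrep x (lrep y v) - lrep y (lrep x v) }.

Variables (V : vectType F) (rho : lieRep V).

Record submod := Submod {
  submod_vs :> {vspace V};
  submodP : forall x v, v \in submod_vs -> rho x v \in submod_vs }.

Definition irreducible : Prop :=
  (fullv : {vspace V}) <> 0%VS /\
  forall U : submod, U = 0%VS :> {vspace V} \/ U = fullv :> {vspace V}.

Section FactorModule.
Variables (B A : submod).

Definition facrep_fun (x : L) : 'End(facv B A) :=
  (facpi B A \o rho x \o linfun vsval)%VF.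

Lemma facrep_funE x u : facrep_fun x u = facpi B A (rho x (vsval u)).
Proof. by rewrite /facrep_fun 2!comp_lfunE [linfun vsval u]lfunE. Qed.

Lemma facrep_fun_linear : linear facrep_fun.
Proof.
move=> a x y; apply/lfunP=> u.
by rewrite add_lfunE scale_lfunE !facrep_funE linearP add_lfunE scale_lfunE linearP.
Qed.
HB.instance Definition _ :=
  GRing.isLinear.Build F L 'End(facv B A) *:%R facrep_fun facrep_fun_linear.

Lemma facpi_rho x v : v \in B ->
  facpi B A (rho x (vsval (facpi B A v))) = facpi B A (rho x v).
Proof.
move=> vB; apply/eqP; rewrite -subr_eq0 -linearB -linearB /=.
have vA : v - vsval (facpi B A v) \in A.
  by apply: facpi_sub; apply: subvP vB; exact: addvSl.
by rewrite -opprB linearN linearN oppr_eq0 facpi_kerP submodP // rpredB ?facpi_inB.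
Qed.

Lemma facrep_subproof x y u :
  linfun facrep_fun (lie x y) u =
    linfun facrep_fun x (linfun facrep_fun y u)
      - linfun facrep_fun y (linfun facrep_fun x u).
Proof.
have uB : vsval u \in B by rewrite -[u]facpiK facpi_inB.
by rewrite !(lfunE facrep_fun) /= !facrep_funE !facpi_rho ?submodP // lrepP linearB.
Qed.

Definition facrep : lieRep (facv B A) := LieRep facrep_subproof.

End FactorModule.

End Modules.
Arguments irreducible {F L V} rho.
Arguments submod {F L V} rho.

Definition composition_series (F : fieldType) (L : lieType F) (V : vectType F)
    (rho : lieRep L V) (n : nat) (U : nat -> submod rho) : Prop :=
  [/\ U 0%N = 0%VS :> {vspace V}, U n = fullv :> {vspace V} &
      forall i, (i < n)%N ->
        (U i <= U i.+1)%VS /\ irreducible (facrep (U i.+1) (U i))].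

Definition semidirect (F : fieldType) (S : lieType F) (V : vectType F)
  of lieRep S V : Type := (V * S)%type.

Section SemiDirect.
Variables (F : fieldType) (S : lieType F) (V : vectType F) (rho : lieRep S V).

HB.instance Definition _ := Vector.on (semidirect rho).

Definition sd_lie (u v : semidirect rho) : semidirect rho :=
  (rho u.2 v.1 - rho v.2 u.1, lie u.2 v.2).

Lemma sd_lie_linearr x : linear (sd_lie x).
Proof.
move=> a u v; rewrite /sd_lie /= !linearP add_lfunE scale_lfunE.
by rewrite -[RHS]/(_ + _, _) /= scalerBr addrACA opprD.
Qed.
Lemma sd_lieC x y : sd_lie x y = - sd_lie y x.
Proof. by rewrite -[RHS]/(- _, - _) /sd_lie /= opprB -lieC. Qed.
Lemma sd_lie_linearl y : linear (sd_lie^~ y).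
Proof.
by move=> a u v; rewrite /= sd_lieC sd_lie_linearr opprD -scalerN -!sd_lieC.
Qed.
Lemma sd_liexx x : sd_lie x x = 0.
Proof. by rewrite /sd_lie subrr liexx. Qed.
Lemma sd_lie_jacobi x y z :
  sd_lie x (sd_lie y z) + sd_lie y (sd_lie z x) + sd_lie z (sd_lie x y) = 0.
Proof.
case: x y z => [u x] [v y] [w z]; rewrite /sd_lie /=.
rewrite -[LHS]/(_ + _ + _, _ + _ + _) /= lie_jacobi; congr (_, _).
have E (a b c d : V) : a - b - (c - d) = (a + d) - (b + c).
  by rewrite opprB addrACA opprD.
rewrite !lrepP (linearB (rho x)) (linearB (rho y)) (linearB (rho z)) /= !E.
set A := rho x (rho y w); set D := rho z (rho y u); set B := rho x (rho z v).
set C := rho y (rho z u); set G := rho y (rho x w); set H := rho z (rho x v).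
rewrite (addrC C) (addrC H) (addrC D).
by rewrite !subrKA subrr.
Qed.

HB.instance Definition _ := isLie.Build F (semidirect rho)
  sd_lie_linearl sd_lie_linearr sd_liexx sd_lie_jacobi.

End SemiDirect.

Section Centralizer.
Variables (F : fieldType) (S : lieType F) (V : vectType F) (rho : lieRep S V).

Lemma centralizer_subproof x s : s \in lker rho -> lie x s \in lker rho.
Proof.
rewrite !memv_ker => /eqP s0; apply/eqP/lfunP => v.
by rewrite lrepP s0 !zero_lfunE linear0 subrr.
Qed.

(* C_S(V) = {s | sV = 0} *)
Definition centralizer : ideal S := Ideal centralizer_subproof.

Definition faithful_map : 'Hom(quotLie centralizer, 'End(V)) :=
  (rho \o linfun vsval)%VF.

Lemma faithful_mapE x : faithful_map (quot_pi centralizer x) = rho x.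
Proof.
rewrite /faithful_map comp_lfunE [linfun vsval _]lfunE /=; apply/eqP.
by rewrite eq_sym -subr_eq0 -linearB -memv_ker; exact: (quot_pi_sub centralizer).
Qed.

Lemma faithful_subproof x y v :
  faithful_map (lie x y) v =
    faithful_map x (faithful_map y v) - faithful_map y (faithful_map x v).
Proof.
by rewrite -[x]quot_piK -[y]quot_piK -quot_pi_morphism !faithful_mapE lrepP.
Qed.

Definition faithful_rep : lieRep (quotLie centralizer) V :=
  LieRep faithful_subproof.

Definition split_ext : lieType F := semidirect faithful_rep.

End Centralizer.

Section Formations.
Variables (F : fieldType) (FF : lieType F -> Prop).

Definition formation : Prop :=
  [/\ forall K, FF K -> soluble K,
      forall (K M : lieType F) (f : 'Hom(K, M)),
        lie_morphism f -> bijective f -> FF K -> FF M,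
      forall (K : lieType F) (A : ideal K), FF K -> FF (quotLie A) &
      forall (K : lieType F) (A B : ideal K),
        FF (quotLie A) -> FF (quotLie B) -> FF (quotLie (ideal_cap A B))].

(* [Phi] is the Frattini subalgebra, an ideal since K is soluble *)
Definition saturated : Prop :=
  forall (K : lieType F) (Phi : ideal K), soluble K ->
    [set x | x \in Phi]%classic = frattini K -> FF (quotLie Phi) -> FF K.

Variables (S : lieType F) (V : vectType F) (rho : lieRep S V).

(* the split extension of V by S / C_S(V); used for irreducible V *)
Definition central_mod : Prop := FF (split_ext rho).
Definition eccentric_mod : Prop := ~ central_mod.

End Formations.

Section Restricted.
Variables (F : fieldType) (p : nat) (L : lieType F).

(* the coefficient of t^j in ad(t x + y)^n (x), computed in L[t] *)
Fixpoint ad_coef (x y : L) (n j : nat) : L :=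
  match n with
  | 0 => if j == 0%N then x else 0
  | n'.+1 => lie y (ad_coef x y n' j)
             + (if j is j'.+1 then lie x (ad_coef x y n' j') else 0)
  end.

Lemma ad_coef_gt x y n j : (n < j)%N -> ad_coef x y n j = 0.
Proof.
elim: n j => [|n IHn] [|j] //= nj.
by rewrite !IHn ?linear0 ?addr0 // ltnW.
Qed.

Lemma ad_coefE (t : F) x y n :
  iter n (lie (t *: x + y)) x = \sum_(j < n.+1) t ^+ j *: ad_coef x y n j.
Proof.
elim: n => [|n IHn]; first by rewrite big_ord1 scale1r.
rewrite iterS IHn linear_sum /=.
under eq_bigr do rewrite linearZ /= lieDl lieZl scalerDr scalerA -exprSr.
rewrite big_split /= addrC.
under [RHS]eq_bigr do rewrite scalerDr.
rewrite [RHS]big_split /=; congr (_ + _).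
  by rewrite [RHS]big_ord_recr /= ad_coef_gt // linear0 scaler0 addr0.
by rewrite [RHS]big_ord_recl /= scaler0 add0r.
Qed.

(* i s_i(x, y) is the coefficient of t^(i-1) in ad(t x + y)^(p-1) (x) *)
Definition jacobson_s (i : nat) (x y : L) : L :=
  (i%:R : F)^-1 *: ad_coef x y p.-1 i.-1.

Definition restricted (pmap : L -> L) : Prop :=
  [/\ forall x y, lie (pmap x) y = iter p (lie x) y,
      forall (a : F) x, pmap (a *: x) = a ^+ p *: pmap x &
      forall x y, pmap (x + y) =
        pmap x + pmap y + \sum_(1 <= i < p) jacobson_s i x y].

End Restricted.

Definition p_envelope (F : fieldType) (p : nat) (S L : lieType F)
    (pmap : L -> L) (j : 'Hom(S, L)) : Prop :=
  [/\ restricted p pmap, lie_morphism j, injective j &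
      forall U : {vspace L}, subalgebra U ->
        (forall x, x \in U -> pmap x \in U) ->
        (forall s, j s \in U) -> U = fullv].

Definition extends (F : fieldType) (S L : lieType F) (j : 'Hom(S, L))
    (V : vectType F) (rho : lieRep S V) (rhoL : lieRep L V) : Prop :=
  forall s, rhoL (j s) = rho s.

(* E (x) V is modelled by row vectors over E, the coordinates with respect to
  the basis [vbasis fullv] of V; [bc v] is 1 (x) v. *)

Lemma linfunE_of (K : fieldType) (U V : vectType K) (f : U -> V) :
  linear f -> linfun f =1 f.
Proof.
move=> fL u; pose fl : {linear U -> V} := HB.pack f (GRing.isLinear.Build K U V *:%R f fL).
exact: (lfunE fl).
Qed.

Definition bchange (F E : fieldType) of {rmorphism F -> E} :=
  fun V : vectType F => 'rV[E]_(\dim {:V}) : Type.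

Section BaseChange.
Variables (F E : fieldType) (iota : {rmorphism F -> E}).
Local Notation bchange := (bchange iota).
Implicit Type V : vectType F.

HB.instance Definition _ V := Vector.on (bchange V).

Definition bc (V : vectType F) (v : V) : bchange V :=
  \row_i iota (coord (vbasis fullv) i v).

Definition bc_basis (V : vectType F) (i : 'I_(\dim {:V})) : V :=
  (vbasis fullv)`_i.

Lemma bcD V (u v : V) : bc (u + v) = bc u + bc v.
Proof. by apply/rowP => i; rewrite !mxE linearD rmorphD. Qed.
Lemma bc0 V : bc (0 : V) = 0.
Proof. by apply/rowP => i; rewrite !mxE linear0 rmorph0. Qed.
Lemma bcZ V a (v : V) : bc (a *: v) = iota a *: bc v.
Proof. by apply/rowP => i; rewrite !mxE linearZ rmorphM. Qed.
Lemma bc_sum V (I : Type) (r : seq I) (f : I -> V) :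
  bc (\sum_(i <- r) f i) = \sum_(i <- r) bc (f i).
Proof. exact: (big_morph _ (@bcD V) (bc0 V)). Qed.

Lemma bc_basisE V (v : V) :
  v = \sum_i coord (vbasis fullv) i v *: bc_basis i.
Proof. by rewrite {1}(coord_vbasis (memvf v)). Qed.

Lemma bc_decomp V (u : bchange V) : u = \sum_i u 0 i *: bc (bc_basis i).
Proof.
rewrite {1}[u]row_sum_delta; apply: eq_bigr => i _; congr (_ *: _).
apply/rowP => k; rewrite !mxE coord_free ?(basis_free (vbasisP _)) //.
by rewrite eqxx eq_sym rmorph_nat.
Qed.

Lemma bc_ind V (P : bchange V -> Prop) :
  P 0 -> (forall a u v, P u -> P v -> P (a *: u + v)) -> (forall v, P (bc v)) ->
  forall u, P u.
Proof.
move=> P0 PD Pbc u; rewrite [u]bc_decomp; elim/big_rec: _ => // i v _ Pv.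
exact: PD.
Qed.

Section Bilinear.
Variables (U V W : vectType F) (b : U -> V -> W).

(* the E-bilinear extension of b *)
Definition bc2 (u : bchange U) (v : bchange V) : bchange W :=
  \sum_i \sum_j (u 0 i * v 0 j) *: bc (b (bc_basis i) (bc_basis j)).

Lemma bc2_linearl v : linear (bc2^~ v).
Proof.
move=> a u u'; rewrite /bc2 scaler_sumr -big_split; apply: eq_bigr => i _ /=.
rewrite scaler_sumr -big_split; apply: eq_bigr => j _ /=.
by rewrite !mxE mulrDl scalerDl -mulrA scalerA.
Qed.

Lemma bc2_linearr u : linear (bc2 u).
Proof.
move=> a v v'; rewrite /bc2 scaler_sumr -big_split; apply: eq_bigr => i _ /=.
rewrite scaler_sumr -big_split; apply: eq_bigr => j _ /=.
by rewrite !mxE mulrDr scalerDl scalerA mulrCA.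
Qed.

Lemma bc2_bc u v : (forall y, linear (b^~ y)) -> (forall x, linear (b x)) ->
  bc2 (bc u) (bc v) = bc (b u v).
Proof.
move=> bl br.
have bsuml y (I : Type) (r : seq I) (c : I -> F) f :
    b (\sum_(i <- r) c i *: f i) y = \sum_(i <- r) c i *: b (f i) y.
  elim/big_rec2: _ => [|i x z _ <-]; last exact: bl.
  by have := bl y (-1) 0 0; rewrite scaler0 addr0 scaleN1r addNr.
have bsumr x (I : Type) (r : seq I) (c : I -> F) f :
    b x (\sum_(i <- r) c i *: f i) = \sum_(i <- r) c i *: b x (f i).
  elim/big_rec2: _ => [|i z t _ <-]; last exact: br.
  by have := br x (-1) 0 0; rewrite scaler0 addr0 scaleN1r addNr.
rewrite {2}[u]bc_basisE {2}[v]bc_basisE bsuml bc_sum; apply: eq_bigr => i _.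
rewrite bsumr scaler_sumr bc_sum; apply: eq_bigr => j _.
by rewrite scalerA bcZ rmorphM !mxE.
Qed.

End Bilinear.

Section BaseChangeLie.
Variable L : lieType F.

Definition bc_lie : bchange L -> bchange L -> bchange L := bc2 (@lie F L).

Lemma bc_lieE x y : bc_lie (bc x) (bc y) = bc (lie x y).
Proof. exact: bc2_bc (@lie_linearl _ L) (@lie_linearr _ L). Qed.

Lemma bc_lie_linearl y : linear (bc_lie^~ y). Proof. exact: bc2_linearl. Qed.
Lemma bc_lie_linearr x : linear (bc_lie x). Proof. exact: bc2_linearr. Qed.

Let bc_lieDl x y z : bc_lie (x + y) z = bc_lie x z + bc_lie y z.
Proof. by have := bc_lie_linearl z 1 x y; rewrite !scale1r. Qed.
Let bc_lieDr x y z : bc_lie z (x + y) = bc_lie z x + bc_lie z y.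
Proof. by have := bc_lie_linearr z 1 x y; rewrite !scale1r. Qed.
Let bc_lie0l x : bc_lie 0 x = 0.
Proof. by apply: (addrI (bc_lie 0 x)); rewrite -bc_lieDl !addr0. Qed.
Let bc_lie0r x : bc_lie x 0 = 0.
Proof. by apply: (addrI (bc_lie x 0)); rewrite -bc_lieDr !addr0. Qed.
Let bc_lieZl a x z : bc_lie (a *: x) z = a *: bc_lie x z.
Proof. by have := bc_lie_linearl z a x 0; rewrite !addr0 bc_lie0l addr0. Qed.
Let bc_lieZr a x z : bc_lie z (a *: x) = a *: bc_lie z x.
Proof. by have := bc_lie_linearr z a x 0; rewrite !addr0 bc_lie0r addr0. Qed.

Lemma bc_lieC x y : bc_lie x y = - bc_lie y x.
Proof.
elim/bc_ind: x => [|a u v IHu IHv|x]; first by rewrite bc_lie0l bc_lie0r oppr0.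
  by rewrite bc_lieDl bc_lieDr bc_lieZl bc_lieZr IHu IHv opprD scalerN.
elim/bc_ind: y => [|a u v IHu IHv|y]; first by rewrite bc_lie0l bc_lie0r oppr0.
  by rewrite bc_lieDl bc_lieDr bc_lieZl bc_lieZr IHu IHv opprD scalerN.
by rewrite !bc_lieE lieC -scaleN1r bcZ rmorphN1 scaleN1r.
Qed.

Lemma bc_liexx x : bc_lie x x = 0.
Proof.
elim/bc_ind: x => [|a u v IHu IHv|x]; first by rewrite bc_lie0l.
  rewrite !(bc_lieDl, bc_lieDr, bc_lieZl, bc_lieZr) IHu IHv !scaler0 add0r addr0.
  by rewrite (bc_lieC v) scalerN addrN.
by rewrite bc_lieE liexx bc0.
Qed.

Lemma bc_lie_jacobi x y z :
  bc_lie x (bc_lie y z) + bc_lie y (bc_lie z x) + bc_lie z (bc_lie x y) = 0.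
Proof.
have D (a : E) (u1 u2 u3 v1 v2 v3 : bchange L) :
    u1 + u2 + u3 = 0 -> v1 + v2 + v3 = 0 ->
    (a *: u1 + v1) + (a *: u2 + v2) + (a *: u3 + v3) = 0.
  move=> u0 v0; rewrite [X in X + _]addrACA -scalerDr addrACA -scalerDr u0 v0.
  by rewrite scaler0 addr0.
have M := (bc_lieDl, bc_lieDr, bc_lieZl, bc_lieZr).
elim/bc_ind: x => [|a u v IHu IHv|x].
- by rewrite !(bc_lie0l, bc_lie0r) !addr0.
- by rewrite !M; apply: D.
elim/bc_ind: y => [|a u v IHu IHv|y].
- by rewrite !(bc_lie0l, bc_lie0r) !addr0.
- by rewrite !M; apply: D.
elim/bc_ind: z => [|a u v IHu IHv|z].
- by rewrite !(bc_lie0l, bc_lie0r) !addr0.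
- by rewrite !M; apply: D.
by rewrite !bc_lieE -!bcD lie_jacobi bc0.
Qed.

HB.instance Definition _ := isLie.Build E (bchange L)
  bc_lie_linearl bc_lie_linearr bc_liexx bc_lie_jacobi.

Variables (V : vectType F) (rho : lieRep L V).

Definition bc_act : bchange L -> bchange V -> bchange V :=
  bc2 (fun x v => rho x v).

Definition bc_rep_fun (x : bchange L) : 'End(bchange V) := linfun (bc_act x).

Lemma bc_rep_funE x v : bc_rep_fun x v = bc_act x v.
Proof. exact: linfunE_of (bc2_linearr _ x) v. Qed.

Lemma bc_rep_fun_linear : linear bc_rep_fun.
Proof.
move=> a x y; apply/lfunP => v.
by rewrite add_lfunE scale_lfunE !bc_rep_funE; apply: bc2_linearl.
Qed.

Lemma bc_rep_bc x v : bc_rep_fun (bc x) (bc v) = bc (rho x v).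
Proof.
rewrite bc_rep_funE /bc_act bc2_bc // => [w a y z|y]; last exact: linearP.
by rewrite linearP add_lfunE scale_lfunE.
Qed.

Lemma bc_rep_subproof x y v :
  linfun bc_rep_fun (lie x y) v =
    linfun bc_rep_fun x (linfun bc_rep_fun y v)
      - linfun bc_rep_fun y (linfun bc_rep_fun x v).
Proof.
rewrite !(linfunE_of bc_rep_fun_linear).
pose f : {linear bchange L -> 'End(bchange V)} :=
  HB.pack bc_rep_fun (GRing.isLinear.Build E _ _ *:%R _ bc_rep_fun_linear).
have fP a u w t : bc_rep_fun (a *: u + w) t = a *: bc_rep_fun u t + bc_rep_fun w t.
  by rewrite bc_rep_fun_linear add_lfunE scale_lfunE.
have f0 t : bc_rep_fun 0 t = 0 by rewrite -[bc_rep_fun]/(f : _ -> _) linear0 zero_lfunE.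
have D (a : E) (u1 u2 u3 v1 v2 v3 : bchange V) :
    u1 = u2 - u3 -> v1 = v2 - v3 ->
    a *: u1 + v1 = (a *: u2 + v2) - (a *: u3 + v3).
  by move=> -> ->; rewrite scalerBr addrACA opprD.
elim/bc_ind: x => [|a u w IHu IHw|x].
- by rewrite [lie _ _]bc_lie0l !f0 linear0 subr0.
- by rewrite [lie _ _]bc_lie_linearl !fP linearP; apply: D.
elim/bc_ind: y => [|a u w IHu IHw|y].
- by rewrite [lie _ _]bc_lie0r !f0 linear0 subr0.
- by rewrite [lie _ _]bc_lie_linearr !fP linearP; apply: D.
elim/bc_ind: v => [|a u w IHu IHw|v].
- by rewrite !(linear0 (bc_rep_fun _)) subr0.
- by rewrite !(linearP (bc_rep_fun _)); apply: D.
by rewrite [lie _ _]bc_lieE !bc_rep_bc lrepP bcD -scaleN1r bcZ rmorphN1 scaleN1r.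
Qed.

Definition bc_rep : lieRep (bchange L) (bchange V) := LieRep bc_rep_subproof.

Lemma bc_repE x v : bc_rep (bc x) (bc v) = bc (rho x v).
Proof. by rewrite /= (linfunE_of bc_rep_fun_linear) bc_rep_bc. Qed.

End BaseChangeLie.

End BaseChange.

Section Clusters.
Variables (F E : fieldType) (iota : {rmorphism F -> E}) (p : nat).
Variables (L : lieType F) (pmap : L -> L).

Definition has_character (M : vectType E) (rho : lieRep (bchange iota L) M)
    (c : L -> E) : Prop :=
  forall x v,
    iter p (rho (bc iota x)) v - rho (bc iota (pmap x)) v = c x ^+ p *: v.

Definition cluster (V : vectType F) (rho : lieRep L V) : set (L -> E) :=
  [set c | linear_for (iota \; *%R) c /\
    exists n (U : nat -> submod (bc_rep iota rho)),
      composition_series n U /\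
      exists2 i, (i < n)%N & has_character (facrep (U i.+1) (U i)) c]%classic.

End Clusters.

(* Main.v *)
(* For S in the formation, an irreducible V is central iff the split extension
   V S lies in the formation; call any S-module with this property split. A
   bilinear image Z of two split modules V, W is split: in the extension of
   V + W + Z, with Z central in the nilpotent ideal V + W + Z, the ideal Z lies
   in the Frattini ideal, so saturation applies. Hence split modules are
   closed under tensor products.

   Call a restricted L-module whose restriction to S is split admissible, and
   let R be the common kernel of the admissible modules. R kills the factors of
   the derived series of S, so its elements are ad-nilpotent, and then
   p-nilpotent by the hypothesis on the centre. As in the proof that tensor
   powers of a faithful module of a restricted Lie algebra contain a free module
   of its restricted enveloping algebra, some vector t of an admissible module
   has linearly independent PBW monomials of L / R.

   If V and W have a common character, Schur's lemma identifies the fields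
   generated by the operators x^p - x^[p] on V and on W, and gives a nonzero
   linear f : V -> W commuting with them. Such maps form a module on which x^p
   acts as x^[p], so R acts nilpotently and Engel's theorem makes f killed by R.
   Then t |-> f extends to the module generated by t, and the evaluation of its
   image at V exhibits W as a bilinear image of split modules.
   Such a common character exists, as clusters are not empty: this uses Schur's
   lemma over the algebraic closure and Jacobson's formula for (x + y)^p. *)

Require Import Defs.
From HB Require Import structures.
From mathcomp Require Import all_boot all_order all_algebra.
From mathcomp Require Import boolp classical_sets.

Set Implicit Arguments.
Unset Strict Implicit.
Unset Printing Implicit Defensive.

Import GRing.Theory.
Local Open Scope ring_scope.

(** * Linear algebra and Lie brackets *)

(* A reflexive decision procedure for equations in abelian groups. *)
Inductive zexpr := ZVar of nat | ZAdd of zexpr & zexpr | ZOpp of zexpr | ZZero.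

Fixpoint zeval (V : zmodType) (env : seq V) (e : zexpr) : V :=
  match e with
  | ZVar i => env`_i
  | ZAdd e1 e2 => zeval env e1 + zeval env e2
  | ZOpp e1 => - zeval env e1
  | ZZero => 0
  end.

Fixpoint zcoef (e : zexpr) (i : nat) : int :=
  match e with
  | ZVar j => if j == i then 1 else 0
  | ZAdd e1 e2 => zcoef e1 i + zcoef e2 i
  | ZOpp e1 => - zcoef e1 i
  | ZZero => 0
  end.

Lemma zeval_coef (V : zmodType) (env : seq V) e :
  zeval env e = \sum_(i < size env) env`_i *~ zcoef e i.
Proof.
elim: e => [j|e1 IH1 e2 IH2|e IH|] /=.
- have [js|sj] := ltnP j (size env).
    rewrite (bigD1 (Ordinal js)) //= eqxx big1 ?addr0 // => i.
    by rewrite -val_eqE /= eq_sym => /negbTE ->.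
  rewrite nth_default // big1 // => i _.
  by rewrite gtn_eqF // (leq_trans (ltn_ord i)).
- by rewrite IH1 IH2 -big_split; apply: eq_bigr => i _; rewrite mulrzDr.
- by rewrite IH -sumrN; apply: eq_bigr => i _; rewrite mulrNz.
- by rewrite big1.
Qed.

Lemma zevalP (V : zmodType) (env : seq V) e1 e2 :
  all (fun i => zcoef e1 i == zcoef e2 i) (iota 0 (size env)) ->
  zeval env e1 = zeval env e2.
Proof.
move=> /allP h; rewrite !zeval_coef; apply: eq_bigr => i _.
by rewrite (eqP (h i _)) // mem_iota /=.
Qed.

(** Atoms are compared up to conversion: [erefl x : x = y] typechecks only for convertible terms. *)
Ltac zlookup x env :=
  match env with
  | cons ?y _ => let _ := constr:(erefl x : x = y) in constr:(0%N)
  | cons _ ?env' => let n := zlookup x env' in constr:(S n)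
  end.
(** The inner [match env] is a fallback: its first branch fails when [t] is not yet listed. *)
Ltac zatoms t env :=
  match t with
  | (?a + ?b)%R => let e := zatoms a env in zatoms b e
  | (- ?a)%R => zatoms a env
  | 0%R => env
  | _ => match env with
         | _ => let n := zlookup t env in env
         | _ => constr:(cons t env)
         end
  end.
Ltac zreify t env :=
  match t with
  | (?a + ?b)%R => let x := zreify a env in let y := zreify b env in constr:(ZAdd x y)
  | (- ?a)%R => let x := zreify a env in constr:(ZOpp x)
  | 0%R => constr:(ZZero)
  | _ => let n := zlookup t env in constr:(ZVar n)
  end.
Ltac zmodule :=
  match goal with
  | |- @eq ?V ?a ?b =>
    let env := zatoms a (@nil V) in let env := zatoms b env in
    let x := zreify a env in let y := zreify b env in
    exact: (@zevalP _ env x y isT)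
  end.

(** The predicate is [Prop]-valued, so the minimum is found by classical descent on [m]. *)
Lemma ex_argmin (T : Type) (m : T -> nat) (P : T -> Prop) :
  (exists x, P x) -> exists2 x, P x & forall y, P y -> (m x <= m y)%N.
Proof.
case=> x0 Px0; have [n] := ubnP (m x0).
elim: n x0 Px0 => // n IHn x Px mx.
have [[y Py ymx]|no] := EM (exists2 y, P y & (m y < m x)%N).
  by apply: IHn Py _; apply: leq_trans ymx _.
exists x => // y Py; rewrite leqNgt; apply/negP => ymx.
by apply: no; exists y.
Qed.

Lemma ex_max_vspace (F : fieldType) (V : vectType F) (P : {vspace V} -> Prop) :
  (exists U, P U) ->
  exists2 U, P U & forall U', P U' -> (U <= U')%VS -> U' = U.
Proof.
move=> /(ex_argmin (fun U => \dim {:V} - \dim U)%N)[U PU maxU].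
exists U => // U' /maxU le sUU'; apply/esym/eqP; rewrite eqEdim sUU'.
by rewrite -(@leq_sub2lE (\dim {:V})) ?dimvS ?subvf.
Qed.

Lemma ex_min_vspace (F : fieldType) (V : vectType F) (P : {vspace V} -> Prop) :
  (exists U, P U) ->
  exists2 U, P U & forall U', P U' -> (U' <= U)%VS -> U' = U.
Proof.
move=> /(ex_argmin (fun U => \dim U))[U PU minU].
by exists U => // U' /minU le sUU'; apply/eqP; rewrite eqEdim sUU'.
Qed.

Lemma mem_add_line (F : fieldType) (V : vectType F) (U : {vspace V}) v w :
  w \in (U + <[v]>)%VS -> exists u a, u \in U /\ w = u + a *: v.
Proof.
case/memv_addP=> u uU [v' /vlineP[a ->] ->].
by exists u, a.
Qed.

Lemma add_line_neq (F : fieldType) (V : vectType F) (U : {vspace V}) v :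
  v \notin U -> (U + <[v]>)%VS <> U.
Proof.
move=> /negP vU e; apply: vU; rewrite -e.
by apply: subvP (memv_line v); exact: addvSr.
Qed.

(** A maximal subspace inside [P] is all of [P]: the line through any further vector of [P] could be
    added to it. *)
Lemma vspace_of_pred (F : fieldType) (V : vectType F) (P : V -> Prop) :
  P 0 -> (forall a u v, P u -> P v -> P (a *: u + v)) ->
  exists U : {vspace V}, forall x, x \in U <-> P x.
Proof.
move=> P0 PD.
have [|U PU maxU] := @ex_max_vspace _ V (fun U => forall x, x \in U -> P x).
  by exists 0%VS => x; rewrite memv0 => /eqP->.
exists U => x; split=> [/PU//|Px]; apply: contrapT => /negP xU.
apply: (add_line_neq xU); apply: maxU (addvSl _ _) => x'.
by move=> /mem_add_line[u [a [/PU uU ->]]]; rewrite addrC; exact: PD.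
Qed.

Lemma linear_Hom (F : fieldType) (V W : vectType F) (f : V -> W) :
  linear f -> exists g : 'Hom(V, W), forall x, g x = f x.
Proof. by move=> lf; exists (linfun f) => x; rewrite linfunE_of. Qed.

Lemma span_map_ind (F : fieldType) (V : vectType F) (X : seq V) (P : V -> Prop) :
  P 0 -> (forall a u v, P u -> P v -> P (a *: u + v)) ->
  (forall x, x \in X -> P x) -> forall v, v \in <<X>>%VS -> P v.
Proof.
move=> P0 PD PX v; have [U UP] := vspace_of_pred P0 PD.
have /subvP XU : (<<X>> <= U)%VS by apply/span_subvP => x /PX /UP.
by move=> /XU /UP.
Qed.

Section LieMisc.
Variables (F : fieldType).
Implicit Types K X L : lieType F.

Lemma lieprodS L (U V : {vspace L}) x y : x \in U -> y \in V -> lie x y \in lieprod U V.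
Proof.
move=> xU yV; rewrite (coord_vbasis xU) (coord_vbasis yV).
have suml (I : finType) (f : I -> L) z : lie (\sum_i f i) z = \sum_i lie (f i) z.
  by elim/big_rec2: _ => [|i a b _ <-]; rewrite ?lie0l ?lieDl.
rewrite suml rpred_sum // => i _; rewrite linear_sum rpred_sum //= => k _.
rewrite lieZl linearZ !rpredZ // memv_span //.
by apply: allpairs_f; rewrite mem_nth ?size_tuple.
Qed.

Lemma lieprod_ind L (U V : {vspace L}) (P : L -> Prop) :
  P 0 -> (forall a u v, P u -> P v -> P (a *: u + v)) ->
  (forall x y, x \in U -> y \in V -> P (lie x y)) ->
  forall z, z \in lieprod U V -> P z.
Proof.
move=> P0 PD Pl; apply: span_map_ind => // _ /allpairsP[[x y] /= [xU yV ->]].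
by apply: Pl; apply: vbasis_mem.
Qed.

Lemma lieprod_sub L (U V W : {vspace L}) :
  (forall x y, x \in U -> y \in V -> lie x y \in W) -> (lieprod U V <= W)%VS.
Proof.
move=> UVW; apply/subvP; apply: lieprod_ind => //; first exact: mem0v.
by move=> a u v uW vW; rewrite memvD ?memvZ.
Qed.

Lemma derivation_derived_series L (d : 'End(L)) n :
  (forall x y, d (lie x y) = lie (d x) y + lie x (d y)) ->
  forall x, x \in derived_series L n -> d x \in derived_series L n.
Proof.
move=> dD; elim: n => [|n IHn] x; first by rewrite !memvf.
move: x; apply: lieprod_ind.
- by rewrite linear0 mem0v.
- by move=> a u v du dv; rewrite linearP /= memvD ?memvZ.
- by move=> x y xD yD; rewrite dD memvD ?lieprodS ?IHn.
Qed.

Lemma lie_leibniz L (x u v : L) : lie x (lie u v) = lie (lie x u) v + lie u (lie x v).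
Proof.
have := lie_jacobi x u v; rewrite (lieC v x) (lieC v (lie x u)) linearN /=.
by move=> /eqP; rewrite subr_eq0 subr_eq addrC => /eqP.
Qed.

Lemma derived_series_ideal L n (x a : L) :
  a \in derived_series L n -> lie x a \in derived_series L n.
Proof.
move=> aD; have [d dE] := linear_Hom (@lie_linearr F L x).
by rewrite -dE; apply: derivation_derived_series aD => u v; rewrite !dE lie_leibniz.
Qed.

End LieMisc.

(** * Formations *)

Section LieMorphisms.
Variable F : fieldType.
Implicit Types K X M : lieType F.

Definition surjective (T U : Type) (f : T -> U) := forall y, exists x, f x = y.

Lemma surj_invK (V W : vectType F) (f : 'Hom(V, W)) :
  surjective f -> cancel f^-1%VF f.
Proof.
by move=> fS y; apply: limg_lfunVK; have [x <-] := fS y; rewrite memv_img ?memvf.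
Qed.

Lemma lker_ideal_subproof K M (f : 'Hom(K, M)) (fM : lie_morphism f) x a :
  a \in lker f -> lie x a \in lker f.
Proof. by rewrite !memv_ker fM => /eqP->; rewrite linear0. Qed.
Definition lker_ideal K M (f : 'Hom(K, M)) (fM : lie_morphism f) : ideal K :=
  Ideal (lker_ideal_subproof fM).

Lemma lie_morphism_derived K M (f : 'Hom(K, M)) n x : lie_morphism f ->
  x \in derived_series K n -> f x \in derived_series M n.
Proof.
move=> fM; elim: n x => [|n IHn]; first by move=> *; exact: memvf.
apply: lieprod_ind => [|a u v fu fv|x y xD yD]; first by rewrite linear0 mem0v.
  by rewrite linearP /= memvD ?memvZ.
by rewrite fM lieprodS ?IHn.
Qed.

Lemma soluble_ext K M (f : 'Hom(K, M)) : lie_morphism f -> soluble M ->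
  (forall x y, f x = 0 -> f y = 0 -> lie x y = 0) -> soluble K.
Proof.
move=> fM [n solM] ab; exists n.+1; apply/eqP; rewrite -subv0.
have f0 x : x \in derived_series K n -> f x = 0.
  by move=> /(lie_morphism_derived fM); rewrite solM memv0 => /eqP.
by apply: lieprod_sub => x y /f0 fx /f0 fy; rewrite ab ?mem0v.
Qed.

Lemma quot_pi_surj K (A : ideal K) : surjective (quot_pi A).
Proof. by move=> u; exists (vsval u); exact: quot_piK. Qed.

Lemma quot_pi_eq0 K (A : ideal K) x : (quot_pi A x == 0) = (x \in A).
Proof. by rewrite facpi_kerP ?memvf. Qed.

End LieMorphisms.

Section FormationTheory.
Variables (F : fieldType) (FF : lieType F -> Prop) (FF_form : formation FF).
Implicit Types K X M : lieType F.

Lemma FF_soluble K : FF K -> soluble K. Proof. by case: FF_form => + _ _ _; apply. Qed.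

(** [M] is isomorphic to the quotient of [K] by the kernel of [f]. *)
Lemma FF_surj K M (f : 'Hom(K, M)) : lie_morphism f -> surjective f -> FF K -> FF M.
Proof.
case: FF_form => _ FFi FFq _ fM fS FFK.
pose A := lker_ideal fM; pose g : 'Hom(quotLie A, M) := (f \o linfun vsval)%VF.
have gE u : g u = f (vsval u) by rewrite comp_lfunE [linfun _ _]lfunE.
have fpi x : f (vsval (quot_pi A x)) = f x.
  by apply/eqP; rewrite eq_sym -subr_eq0 -linearB -memv_ker; exact: (quot_pi_sub A).
apply: (FFi _ _ g) (FFq _ A FFK) => [u v|].
  by rewrite !gE -fM -[u]quot_piK -[v]quot_piK -quot_pi_morphism !fpi !fM !fpi.
have g0 : lker g == 0%VS.
  rewrite -subv0; apply/subvP => u; rewrite memv_ker gE memv0 => /eqP fu.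
  by rewrite -[u]quot_piK quot_pi_eq0 memv_ker fu.
exists (g^-1)%VF; first exact: lker0_lfunK.
by apply: surj_invK => y; have [x <-] := fS y; exists (quot_pi A x); rewrite gE fpi.
Qed.

(** The quotients of [X] by the two kernels are images of [K] and [M], so the class contains [X]
    modulo their intersection, which is zero. *)
Lemma FF_subdirect X K M (f : 'Hom(X, K)) (g : 'Hom(X, M)) :
  lie_morphism f -> surjective f -> lie_morphism g -> surjective g ->
  (forall x, f x = 0 -> g x = 0 -> x = 0) -> FF K -> FF M -> FF X.
Proof.
move=> fM fS gM gS fg0 FFK FFM; case: (FF_form) => _ FFi _ FFc.
have FFquot (N : lieType F) (h : 'Hom(X, N)) (hM : lie_morphism h) : surjective h -> FF N ->
    FF (quotLie (lker_ideal hM)).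
  move=> hS; pose k := (quot_pi (lker_ideal hM) \o h^-1)%VF.
  have kh x : k (h x) = quot_pi (lker_ideal hM) x.
    rewrite comp_lfunE; apply: quot_pi_eq.
    by rewrite memv_ker linearB /= surj_invK ?subrr.
  apply: (@FF_surj _ _ k) => [u v|u].
    have [x <-] := hS u; have [y <-] := hS v.
    by rewrite -hM !kh quot_pi_morphism.
  by exists (h (vsval u)); rewrite kh quot_piK.
have := FFc X _ _ (FFquot _ _ fM fS FFK) (FFquot _ _ gM gS FFM).
set A := ideal_cap _ _ => FFA.
have A0 x : x \in A -> x = 0.
  by rewrite memv_cap !memv_ker => /andP[/eqP/fg0 h /eqP /h].
have pi0 : lker (quot_pi A) == 0%VS.
  rewrite -subv0; apply/subvP => x; rewrite memv_ker quot_pi_eq0 memv0.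
  by move/A0->.
have piK := lker0_lfunK pi0; have piVK := surj_invK (@quot_pi_surj _ _ A).
apply: (FFi _ _ ((quot_pi A)^-1)%VF _ _ FFA); last by exists (quot_pi A).
move=> u v; rewrite -[u]piVK -[v]piVK -quot_pi_morphism.
by rewrite !piK.
Qed.

End FormationTheory.

(** * The Frattini ideal of a soluble Lie algebra *)

Section FrattiniIdeal.
Variables (F : fieldType) (K : lieType F).
Implicit Types (U : {vspace K}) (a x y z : K).

(* For [a] in an ideal abelian modulo [C], the map [1 - ad a] is an
  automorphism modulo [C], so it permutes the maximal subalgebras containing
  [C]. *)
Section Twist.
Variables (A C : ideal K).
Hypothesis CA : forall x y, x \in A -> y \in A -> lie x y \in C.

Let twist a : 'End(K) := linfun (fun x => x - lie a x).

Let twistE a x : twist a x = x - lie a x.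
Proof.
by apply: linfunE_of => k u v; rewrite linearP /= scalerBr opprD addrACA.
Qed.

(** (1 + ad a)(1 - ad a) = 1 - (ad a)^2, and (ad a)^2 maps [K] into [C]. *)
Let twistNK a x : a \in A -> x - twist (- a) (twist a x) \in C.
Proof.
move=> aA; rewrite !twistE lieNl opprK linearB /= addrA subrK subKr.
by rewrite CA // lieC rpredN idealP.
Qed.

Let twist_sub a U : a \in A -> (C <= U)%VS ->
  subalgebra U -> subalgebra (twist a @^-1: U)%VS.
Proof.
move=> aA /subvP CU sU x y; rewrite -!memv_preim !twistE => xU yU.
(* The error term [[a, x], [a, y]] lies in [C], since both entries lie in [A]. *)
have -> : lie x y - lie a (lie x y) =
    lie (x - lie a x) (y - lie a y) - lie (lie a x) (lie a y).
  rewrite lie_leibniz lieBl !linearB /= -[RHS]addrA -!opprD subrK.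
  by rewrite opprD addrA addrAC.
by apply: memvB; [apply: sU | apply: CU; apply: CA; exact: idealPl].
Qed.

Lemma maximal_subalgebra_twist M a : a \in A -> (C <= M)%VS ->
  maximal_subalgebra M -> maximal_subalgebra (twist a @^-1: M)%VS.
Proof.
move=> aA CM [sM Mf maxM]; have NaA : - a \in A by rewrite rpredN.
(* Subspaces containing [C] do not see the difference between x and its double twist, so the twists
   by b and -b are inverse to each other on them. *)
have in_twist U x b : b \in A -> (C <= U)%VS ->
    (twist (- b) (twist b x) \in U) = (x \in U).
  move=> bA /subvP/(_ _ (twistNK x bA)) xU; apply/idP/idP => h.
    by rewrite -[x](subrK (twist (- b) (twist b x))) memvD.
  by rewrite -[twist _ _](subKr x) memvB.
have in_twistN U x b : b \in A -> (C <= U)%VS ->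
    (twist b (twist (- b) x) \in U) = (x \in U).
  by move=> bA CU; rewrite -{1}[b]opprK in_twist ?rpredN.
have CU b : b \in A -> (C <= twist b @^-1: M)%VS.
  move=> bA; apply/subvP => c cC; rewrite -memv_preim twistE.
  by apply: (subvP CM); rewrite memvB ?idealP.
split; first exact: twist_sub.
  apply: contraNneq Mf => e.
  rewrite eqEsubv subvf; apply/subvP => x _.
  by rewrite -(in_twistN _ _ a) // memv_preim e memvf.
move=> U sU MU; have CsU : (C <= U)%VS by apply: subv_trans MU; exact: CU.
case: (maxM (twist (- a) @^-1: U)%VS).
- exact: twist_sub.
- apply/subvP => x xM; rewrite -memv_preim (subvP MU) // -memv_preim.
  by rewrite in_twistN.
- move=> e; left; apply/eqP; rewrite eqEsubv MU andbT; apply/subvP => z zU.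
  by rewrite -memv_preim -e -memv_preim in_twist.
- move=> e; right; apply/eqP; rewrite eqEsubv subvf; apply/subvP => z _.
  by rewrite -(in_twist _ _ a) // memv_preim e memvf.
Qed.

(** [x] lies in [M] and in its twist, so [M] contains both x and x - [a, x]. *)
Lemma lie_frattini_twist M a x : a \in A -> (C <= M)%VS ->
  maximal_subalgebra M -> frattini K x -> lie a x \in M.
Proof.
move=> aA CM maxM xPhi; have xM : x \in M by exact: xPhi.
have : x \in (twist a @^-1: M)%VS by apply: xPhi; exact: maximal_subalgebra_twist.
by rewrite -memv_preim twistE => h; rewrite -[lie a x](subKr x) memvB.
Qed.

End Twist.

(** Let [C] be a maximal ideal of [K] inside [M]. The last derived term not inside [C] gives an
    ideal [A] above [C], abelian modulo [C], and M + A = K. For y = u + a, [u, x] lies in [M]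
    because u and x do, and [a, x] by twisting. *)
Lemma lie_frattini x y M : soluble K -> maximal_subalgebra M ->
  frattini K x -> lie y x \in M.
Proof.
move=> [n solK] maxM xPhi; have [sM Mf hM] := maxM.
pose isid U := forall x a, a \in U -> lie x a \in U.
have [|C0 [C0M C0id] maxC] := @ex_max_vspace _ K (fun U => (U <= M)%VS /\ isid U).
  by exists 0%VS; split; [exact: sub0v | move=> z a; rewrite !memv0 => /eqP->; rewrite linear0].
pose C := Ideal C0id.
have [m DmC DSmC] : exists2 m, ~~ (derived_series K m <= C)%VS &
    (derived_series K m.+1 <= C)%VS.
  have : (derived_series K n <= C)%VS by rewrite solK sub0v.
  elim: n {solK} => [|n IHn] Dn.
    by move: Mf; rewrite eqEsubv subvf (subv_trans Dn C0M).
  by have [/IHn//|DnC] := boolP (derived_series K n <= C)%VS; exists n.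
have Aid : isid (derived_series K m + C)%VS.
  move=> z _ /memv_addP[d dD [c cC ->]].
  by rewrite linearD memv_add ?derived_series_ideal ?C0id.
pose A := Ideal Aid.
have CA u v : u \in A -> v \in A -> lie u v \in C.
  move=> /memv_addP[d dD [c cC ->]] /memv_addP[d' dD' [c' cC' ->]].
  rewrite lieDl linearD /= -addrA; apply: memvD; first by rewrite (subvP DSmC) ?lieprodS.
  by apply: memvD; [apply: (@idealP _ _ C) | apply: (@idealPl _ _ C)].
(* If M + A were [M], the ideal [A] would lie inside [M], and maximality of [C] would force A =
   C. *)
have AM : (M + A)%VS = fullv.
  case: (hM (M + A)%VS) => //; last first.
  - move=> e; case/negP: DmC; rewrite -[C : {vspace _}](maxC A) ?addvSl ?addvSr //.
    by split=> //; rewrite -e addvSr.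
  - exact: addvSl.
  move=> _ _ /memv_addP[u uM [a aA ->]] /memv_addP[v vM [b bA ->]].
  rewrite lieDl linearD /= -addrA; apply: memv_add; first exact: sM.
  by apply: memvD; [apply: (@idealP _ _ A) | apply: (@idealPl _ _ A)].
have : y \in (M + A)%VS by rewrite AM memvf.
case/memv_addP=> u uM [a aA ->]; rewrite lieDl; apply: memvD.
  by apply: sM => //; exact: xPhi.
exact: (lie_frattini_twist CA aA C0M maxM xPhi).
Qed.

Lemma frattini_ideal : soluble K ->
  exists Phi : ideal K, [set x | x \in Phi]%classic = frattini K.
Proof.
move=> solK; have [||U UP] := @vspace_of_pred _ K (frattini K).
- by move=> M _; exact: mem0v.
- by move=> a u v uP vP M maxM; apply: memvD; [apply: memvZ; exact: uP | exact: vP].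
have Uid x a : a \in U -> lie x a \in U.
  by move=> /UP aP; apply/UP => M maxM; exact: lie_frattini.
by exists (Ideal Uid); apply/seteqP; split=> x /UP.
Qed.

End FrattiniIdeal.

Section Saturation.
Variables (F : fieldType) (FF : lieType F -> Prop).
Hypotheses (FF_form : formation FF) (FF_sat : saturated FF).

(** The kernel of [g] lies in the Frattini ideal [Phi], so the projection onto X / Phi factors
    through [g] and X / Phi is an image of [M]. *)
Lemma FF_saturated (X M : lieType F) (g : 'Hom(X, M)) :
  lie_morphism g -> surjective g -> soluble X ->
  (forall x, g x = 0 -> frattini X x) -> FF M -> FF X.
Proof.
move=> gM gS solX gPhi FFM; have [Phi PhiE] := frattini_ideal solX.
apply: (FF_sat solX PhiE).
pose k := (quot_pi Phi \o g^-1)%VF.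
have kg x : k (g x) = quot_pi Phi x.
  rewrite comp_lfunE; apply: quot_pi_eq.
  have : frattini X (g^-1%VF (g x) - x) by apply: gPhi; rewrite linearB /= surj_invK ?subrr.
  by rewrite -PhiE.
apply: (@FF_surj _ _ FF_form _ _ k) FFM => [u v|u].
  have [x <-] := gS u; have [y <-] := gS v.
  by rewrite -gM !kg quot_pi_morphism.
by exists (g (vsval u)); rewrite kg quot_piK.
Qed.

End Saturation.

(** * Constructions of representations *)

Section Representations.
Variables (F : fieldType) (L : lieType F).

Section MkRep.
Variables (V : vectType F) (f : L -> V -> V).
Hypotheses (fl : forall v, linear (f^~ v)) (fr : forall x, linear (f x)).
Hypothesis fb : forall x y v, f (lie x y) v = f x (f y v) - f y (f x v).

Let fE x v : linfun (f x) v = f x v. Proof. exact: linfunE_of. Qed.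

Let f_linear : linear (fun x => linfun (f x) : 'End(V)).
Proof.
by move=> a x y; apply/lfunP => v; rewrite add_lfunE scale_lfunE !fE fl.
Qed.

Let mkrep_subproof x y v :
  linfun (fun x => linfun (f x) : 'End(V)) (lie x y) v =
  linfun (fun x => linfun (f x) : 'End(V)) x
    (linfun (fun x => linfun (f x) : 'End(V)) y v) -
  linfun (fun x => linfun (f x) : 'End(V)) y
    (linfun (fun x => linfun (f x) : 'End(V)) x v).
Proof. by rewrite !(linfunE_of f_linear) !fE fb. Qed.

Definition mkrep : lieRep L V := LieRep mkrep_subproof.

Lemma mkrepE x v : mkrep x v = f x v.
Proof. by rewrite /= (linfunE_of f_linear) fE. Qed.
End MkRep.

Lemma lrepPl (V : vectType F) (rho : lieRep L V) a x y v :
  rho (a *: x + y) v = a *: rho x v + rho y v.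
Proof. by rewrite linearP add_lfunE scale_lfunE. Qed.

Section Sum.
Variables (V W : vectType F) (rho : lieRep L V) (sigma : lieRep L W).

Definition sumact (x : L) (u : V * W) : V * W := (rho x u.1, sigma x u.2).

Lemma sumact_linearl u : linear (sumact^~ u).
Proof. by move=> a x y; rewrite /sumact !linearP !add_lfunE !scale_lfunE. Qed.
Lemma sumact_linearr x : linear (sumact x).
Proof. by move=> a u v; rewrite /sumact /= !linearP. Qed.
Lemma sumact_lie x y u :
  sumact (lie x y) u = sumact x (sumact y u) - sumact y (sumact x u).
Proof. by rewrite /sumact !lrepP. Qed.

Definition sumrep := mkrep sumact_linearl sumact_linearr sumact_lie.

Lemma sumrepE x u : sumrep x u = (rho x u.1, sigma x u.2).
Proof. exact: mkrepE. Qed.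
End Sum.

Section HomRep.
Variables (V W : vectType F) (rho : lieRep L V) (sigma : lieRep L W).

Definition homact (x : L) (f : 'Hom(V, W)) : 'Hom(V, W) :=
  ((sigma x \o f) - (f \o rho x))%VF.

Lemma homactE x f v : homact x f v = sigma x (f v) - f (rho x v).
Proof. by rewrite add_lfunE opp_lfunE !comp_lfunE. Qed.

Lemma homact_linearl f : linear (homact^~ f).
Proof.
move=> a x y; apply/lfunP => v; rewrite [RHS]add_lfunE [X in _ = X + _]scale_lfunE !homactE.
by rewrite !lrepPl linearP scalerBr opprD addrACA.
Qed.
Lemma homact_linearr x : linear (homact x).
Proof.
move=> a f g; apply/lfunP => v; rewrite [RHS]add_lfunE [X in _ = X + _]scale_lfunE !homactE.
by rewrite !add_lfunE !scale_lfunE linearP scalerBr opprD addrACA.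
Qed.
Lemma homact_lie x y f :
  homact (lie x y) f = homact x (homact y f) - homact y (homact x f).
Proof.
apply/lfunP => v; rewrite [RHS]add_lfunE [X in _ = _ + X]opp_lfunE !homactE !lrepP !linearB /=.
zmodule.
Qed.

Definition homrep := mkrep homact_linearl homact_linearr homact_lie.

Lemma homrepE x f v : homrep x f v = sigma x (f v) - f (rho x v).
Proof. by rewrite mkrepE homactE. Qed.
End HomRep.

Section SubRep.
Variables (V : vectType F) (rho : lieRep L V) (U : submod rho).

Definition subact (x : L) (u : subvs_of U) : subvs_of U := vsproj U (rho x (vsval u)).

Lemma vsval_subact x u : vsval (subact x u) = rho x (vsval u).
Proof. by rewrite vsprojK // submodP ?subvsP. Qed.
Lemma subact_linearl u : linear (subact^~ u).
Proof. by move=> a x y; rewrite /subact lrepPl linearP. Qed.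
Lemma subact_linearr x : linear (subact x).
Proof. by move=> a u v; rewrite /subact !linearP. Qed.
Lemma subact_lie x y u :
  subact (lie x y) u = subact x (subact y u) - subact y (subact x u).
Proof. by apply: val_inj; rewrite linearB /= !vsval_subact lrepP. Qed.

Definition subrep := mkrep subact_linearl subact_linearr subact_lie.

Lemma subrepE x u : vsval (subrep x u) = rho x (vsval u).
Proof. by rewrite mkrepE vsval_subact. Qed.
End SubRep.

Section TrivRep.
Variables (V : vectType F).
Lemma trivact_linearl (v : V) : linear (fun _ : L => (0 : V)).
Proof. by move=> a x y; rewrite scaler0 addr0. Qed.
Lemma trivact_linearr (x : L) : linear (fun _ : V => (0 : V)).
Proof. by move=> a x' y; rewrite scaler0 addr0. Qed.
Definition trivrep : lieRep L V := mkrep trivact_linearl trivact_linearr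
  (fun _ _ _ => esym (subrr 0)).
Lemma trivrepE x v : trivrep x v = 0.
Proof. exact: mkrepE. Qed.
End TrivRep.

End Representations.

Section Pullback.
Variables (F : fieldType) (S L : lieType F) (g : 'Hom(S, L)) (gM : lie_morphism g).
Variables (V : vectType F) (rho : lieRep L V).

Lemma pull_linearl v : linear (fun s => rho (g s) v).
Proof. by move=> a x y; rewrite linearP lrepPl. Qed.
Lemma pull_linearr s : linear (rho (g s)).
Proof. exact: linearP. Qed.
Lemma pull_lie x y v :
  rho (g (lie x y)) v = rho (g x) (rho (g y) v) - rho (g y) (rho (g x) v).
Proof. by rewrite gM lrepP. Qed.

Definition pullrep : lieRep S V := mkrep pull_linearl pull_linearr pull_lie.

Lemma pullrepE s v : pullrep s v = rho (g s) v.
Proof. exact: mkrepE. Qed.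
End Pullback.

(** * Split extensions in a saturated formation *)

Section SplitExtensions.
Variables (F : fieldType) (FF : lieType F -> Prop) (FF_form : formation FF).
Implicit Types (S Q X K : lieType F) (V W Z : vectType F).

Lemma FF_image K X (f : K -> X) : linear f ->
  (forall x y, f (lie x y) = lie (f x) (f y)) -> surjective f -> FF K -> FF X.
Proof.
move=> /linear_Hom[g gE] fM fS; apply: (@FF_surj _ _ FF_form _ _ g).
  by move=> x y; rewrite !gE.
by move=> y; have [x <-] := fS y; exists x.
Qed.

Lemma FF_subdirect_fun X K Q (f : X -> K) (g : X -> Q) :
  linear f -> (forall x y, f (lie x y) = lie (f x) (f y)) -> surjective f ->
  linear g -> (forall x y, g (lie x y) = lie (g x) (g y)) -> surjective g ->
  (forall x, f x = 0 -> g x = 0 -> x = 0) -> FF K -> FF Q -> FF X.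
Proof.
move=> /linear_Hom[f' fE] fM fS /linear_Hom[g' gE] gM gS fg.
apply: (@FF_subdirect _ _ FF_form _ _ _ f' g') => [x y|y|x y|y|x].
- by rewrite !fE.
- by have [x <-] := fS y; exists x.
- by rewrite !gE.
- by have [x <-] := gS y; exists x.
- by rewrite fE gE; exact: fg.
Qed.

Lemma sd_lieE S V (rho : lieRep S V) (x y : semidirect rho) :
  lie x y = (rho x.2 y.1 - rho y.2 x.1, lie x.2 y.2) :> semidirect rho.
Proof. by []. Qed.

Lemma sd_snd_linear S V (rho : lieRep S V) :
  linear (fun x : semidirect rho => x.2).
Proof. by []. Qed.

Lemma sd_snd_surj S V (rho : lieRep S V) :
  surjective (fun x : semidirect rho => x.2).
Proof. by move=> s; exists (0, s). Qed.

Section ChangeActing.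
Variables (S Q : lieType F) (g : S -> Q) (V : vectType F).
Hypotheses (gl : linear g) (gM : forall x y, g (lie x y) = lie (g x) (g y)).
Hypothesis gS : surjective g.
Variables (rho : lieRep S V) (sigma : lieRep Q V).
Hypothesis rhoE : forall s v, rho s v = sigma (g s) v.

Let h (x : semidirect rho) : semidirect sigma := (x.1, g x.2).

Let hl : linear h. Proof. by move=> a x y; rewrite /h /= gl. Qed.
Let hM x y : h (lie x y) = lie (h x) (h y).
Proof. by rewrite !sd_lieE /h /= gM !rhoE. Qed.
Let hS : surjective h.
Proof. by move=> [v q]; have [s <-] := gS q; exists (v, s). Qed.

Lemma FF_split_image : FF (semidirect rho) -> FF (semidirect sigma).
Proof. exact: FF_image hl hM hS. Qed.

(** The split extension by [S] is a subdirect product of [S] and of the split extension by [Q]. *)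
Lemma FF_split_pull : FF S -> FF (semidirect sigma) -> FF (semidirect rho).
Proof.
apply: FF_subdirect_fun (@sd_snd_linear _ _ rho) _ (@sd_snd_surj _ _ rho) hl hM hS _.
  by [].
by move=> [v s] /= -> [->].
Qed.
End ChangeActing.

(** [S] may act in place of its quotient by the centralizer: one direction is a surjection, the
    other a subdirect product. *)
Lemma FF_split_ext S V (rho : lieRep S V) : FF S ->
  central_mod FF rho <-> FF (semidirect rho).
Proof.
move=> FFS; have gS := @quot_pi_surj _ _ (centralizer rho).
have gM := @quot_pi_morphism _ _ (centralizer rho).
have rhoE s v : rho s v = faithful_rep rho (quot_pi _ s) v by rewrite faithful_mapE.
have gl : linear (quot_pi (centralizer rho)) by exact: linearP.
split; first exact: (FF_split_pull gl gM gS rhoE FFS).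
exact: (FF_split_image gl gM gS rhoE).
Qed.

Section AbelianIdeal.
Variables (X S : lieType F) (Z : vectType F) (rho : lieRep S Z).
Variables (i : Z -> X) (g : X -> S).
Hypotheses (il : linear i) (ii : forall z, i z = 0 -> z = 0).
Hypotheses (gl : linear g) (gM : forall x y, g (lie x y) = lie (g x) (g y)).
Hypothesis gS : surjective g.
Hypothesis iE : forall x z, lie x (i z) = i (rho (g x) z).
Hypothesis i0 : forall z z', rho (g (i z)) z' = 0.

(** The semidirect product of [Z] by [X] is a subdirect product of two copies of [X] under (z, x)
    |-> x and (z, x) |-> z + x; then [g] maps it onto the extension by [S]. *)
Lemma FF_split_abelian_ideal : FF X -> FF (semidirect rho).
Proof.
move=> FFX; have [g' gE] := linear_Hom gl.
have gM' : lie_morphism g' by move=> x y; rewrite !gE.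
pose tau := pullrep gM' rho; have tauE x z : tau x z = rho (g x) z by rewrite pullrepE gE.
apply: (@FF_split_image _ _ g _ gl gM gS tau) => //.
pose h (x : semidirect tau) : X := i x.1 + x.2.
have iB u v : i (u - v) = i u - i v by rewrite addrC -scaleN1r il scaleN1r addrC.
have iz : i 0 = 0 by rewrite -(subrr (0 : Z)) iB subrr.
have iab u v : lie (i u) (i v) = 0 by rewrite iE i0 iz.
apply: (@FF_subdirect_fun (semidirect tau) X X (fun x : semidirect tau => x.2) h) => //.
- exact: sd_snd_surj.
- by move=> a x y; rewrite /h /= il scalerDr addrACA.
- move=> x y; rewrite !sd_lieE /h /= iB !tauE -!iE lieDl !linearD /=.
  by rewrite iab (lieC (i x.1)); zmodule.
- by move=> x; exists (0, x); rewrite /h /= iz add0r.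
by move=> [z x] /= -> ; rewrite /h /= addr0 => /ii ->.
Qed.
End AbelianIdeal.

Lemma FF_split_sum S V W (rho : lieRep S V) (sigma : lieRep S W) :
  FF (semidirect rho) -> FF (semidirect sigma) -> FF (semidirect (sumrep rho sigma)).
Proof.
pose f (x : semidirect (sumrep rho sigma)) : semidirect rho := (x.1.1, x.2).
pose g (x : semidirect (sumrep rho sigma)) : semidirect sigma := (x.1.2, x.2).
apply: (@FF_subdirect_fun _ _ _ f g) => //.
- by move=> x y; rewrite !sd_lieE /f /= !sumrepE.
- by move=> [v s]; exists ((v, 0), s).
- by move=> x y; rewrite !sd_lieE /g /= !sumrepE.
- by move=> [v s]; exists ((0, v), s).
by move=> [[v w] s] [/= -> ->] [/= ->].
Qed.

End SplitExtensions.

(** * Bilinear images of split modules *)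

Section Bilinear.
Variables (F : fieldType) (FF : lieType F -> Prop).
Hypotheses (FF_form : formation FF) (FF_sat : saturated FF).
Variables (S : lieType F) (V W Z : vectType F).
Variables (rV : lieRep S V) (rW : lieRep S W) (rZ : lieRep S Z) (b : V -> W -> Z).
Hypotheses (bl : forall w, linear (b^~ w)) (br : forall v, linear (b v)).
Hypothesis bE : forall s v w, rZ s (b v w) = b (rV s v) w + b v (rW s w).
Hypothesis b_span : forall U : {vspace Z}, (forall v w, b v w \in U) -> U = fullv.

Let K : lieType F := semidirect rV.

(* With this action, [V + W + Z] is a nilpotent ideal of [(W * Z) K] whose
  derived ideal [Z] lies in the Frattini ideal. *)
Let act (k : K) (u : W * Z) : W * Z := (rW k.2 u.1, rZ k.2 u.2 + b k.1 u.1).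

Let act_linearl u : linear (act^~ u).
Proof.
move=> a x y; rewrite /act /= !lrepPl bl.
by rewrite -[RHS]/(_ + _, _ + _) /=; congr (_, _); rewrite scalerDr addrACA.
Qed.
Let act_linearr k : linear (act k).
Proof.
move=> a x y; rewrite /act /= !linearP br.
by rewrite -[RHS]/(_ + _, _ + _) /=; congr (_, _); rewrite scalerDr addrACA.
Qed.
Let act_lie x y u : act (lie x y) u = act x (act y u) - act y (act x u).
Proof.
have bB v v' w : b (v - v') w = b v w - b v' w.
  by rewrite addrC -scaleN1r bl scaleN1r addrC.
rewrite /act sd_lieE -[RHS]/(_ - _, _ - _) /= !lrepP; congr (_, _).
by rewrite bB (linearD (rZ x.2)) (linearD (rZ y.2)) /= !bE; zmodule.
Qed.

Let tau : lieRep K (W * Z)%type := mkrep act_linearl act_linearr act_lie.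
Let tauE k u : tau k u = (rW k.2 u.1, rZ k.2 u.2 + b k.1 u.1).
Proof. exact: mkrepE. Qed.

Let X : lieType F := semidirect tau.

(** A maximal [M] not containing [Z] satisfies M + Z = X, so it contains each v and each w up to an
    element of [Z]. As [Z] commutes with V + W + Z, their bracket b v w lies in [M]; these values
    span [Z]. *)
Let Z_frattini z : frattini X ((0, z), 0).
Proof.
move=> M [sM Mf maxM] /=.
have b0l w : b 0 w = 0.
  by have := bl w (-1) 0 0; rewrite scaler0 addr0 scaleN1r addNr.
have b0r v : b v 0 = 0.
  by have := br v (-1) 0 0; rewrite scaler0 addr0 scaleN1r addNr.
pose i (z : Z) : X := ((0, z), 0).
have [i' iE] : exists i' : 'Hom(Z, X), forall z, i' z = i z.
  by apply: linear_Hom => a u v; rewrite /i -[RHS]/((a *: 0 + 0, a *: u + v), a *: 0 + 0) !scaler0 !addr0.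
have Zid x u : lie x (i u) = i (rZ x.2.2 u).
  rewrite sd_lieE /i /= (linear0 tau) zero_lfunE subr0 tauE /=.
  by rewrite !linear0 b0r addr0.
pose Z' := limg i'.
have ZM : (Z' <= M)%VS.
  have [||eM|eX] := maxM (M + Z')%VS.
  - move=> x' y' /memv_addP[x xM [_ /memv_imgP[u _ ->] ->]] /memv_addP[y yM [_ /memv_imgP[v _ ->] ->]]; rewrite !iE.
    rewrite lieDl !linearD /= -addrA memv_add ?sM // (lieC (i u)) !Zid -!iE.
    by rewrite !memvD ?memvN ?memv_img ?memvf.
  - exact: addvSl.
  - by rewrite -eM addvSr.
  have inM x : exists2 u, x + i u \in M & True.
    have : x \in (M + Z')%VS by rewrite eX memvf.
    case/memv_addP=> y yM [_ /memv_imgP[u _ ->] ->].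
    by exists (- u) => //; rewrite -iE linearN addrK.
  suff : (i' @^-1: M)%VS = fullv.
    move=> e; apply/subvP => _ /memv_imgP[u _ ->]; rewrite memv_preim.
    by rewrite e memvf.
  apply: b_span => v w; rewrite -memv_preim iE.
  have [u1 v1M _] := inM (0, (v, 0)); have [u2 w2M _] := inM ((w, 0), 0).
  have := sM _ _ v1M w2M; rewrite lieDl !linearD /= (lieC (i u1)) !Zid /=.
  rewrite !sd_lieE /= !tauE /=.
  rewrite !linear0 !zero_lfunE ?b0l ?b0r.
  rewrite -[i 0]iE (linear0 i') oppr0 !addr0 !add0r subr0.
  by rewrite -[(0, 0)]/(0 : W * Z) subr0.
by apply: (subvP ZM); rewrite -[(_, _)]/(i z) -iE memv_img ?memvf.
Qed.

(** [X] modulo [Z] is the extension of [W] by that of [V] by [S], a member of the class. Saturation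
    puts [X] in the class, and [Z] is an abelian ideal of [X] on which [X] acts through [S]. *)
Lemma FF_split_bilinear :
  FF (semidirect rV) -> FF (semidirect rW) -> FF (semidirect rZ).
Proof.
move=> FFV FFW.
have sl : linear (fun k : K => k.2) by exact: sd_snd_linear.
have [s sE] := linear_Hom sl.
have sM : lie_morphism s by move=> x y; rewrite !sE.
have sS : surjective (fun k : K => k.2) by exact: sd_snd_surj.
pose rW' : lieRep K W := pullrep sM rW.
have rW'E k w : rW' k w = rW k.2 w by rewrite pullrepE sE.
have FFW' : FF (semidirect rW').
  by apply: (FF_split_pull FF_form sl _ sS rW'E FFV FFW).
pose g (x : X) : semidirect rW' := (x.1.1, x.2).
have gl : linear g by [].
have [g' gE] := linear_Hom gl.
have gM : lie_morphism g'.
  by move=> x y; rewrite !gE /g !sd_lieE /= !tauE !rW'E.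
have FFX : FF X.
  apply: (FF_saturated FF_form FF_sat gM _ _ _ FFW') => [[w k]||[[w z] k]].
  - by exists ((w, 0), k); rewrite gE.
  - apply: (soluble_ext gM); first exact: FF_soluble FFW'.
    move=> [[w z] k] [[w' z'] k']; rewrite !gE /g /= => -[-> ->] [-> ->].
    by rewrite sd_lieE /= !linear0 !zero_lfunE subr0.
  by rewrite gE /g /= => -[-> ->]; exact: Z_frattini.
apply: (@FF_split_abelian_ideal _ _ FF_form X S Z rZ
  (fun z => ((0, z), 0)) (fun x => x.2.2)) => //.
- move=> a u v.
  by rewrite -[RHS]/((a *: 0 + 0, a *: u + v), a *: 0 + 0) !scaler0 !addr0.
- by move=> z [].
- by move=> s0; exists (0, (0, s0)).
- move=> x z; rewrite sd_lieE /= (linear0 tau) zero_lfunE subr0 tauE /=.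
  have b0r v : b v 0 = 0.
    by have := br v (-1) 0 0; rewrite scaler0 addr0 scaleN1r addNr.
  by rewrite !linear0 b0r addr0.
by move=> z z'; rewrite linear0 zero_lfunE.
Qed.

End Bilinear.

(** * p-th powers *)

Section PPowers.
Variables (F : fieldType) (p : nat).
Hypothesis charF : p \in [pchar F].

Lemma iter_lfunD (U : vectType F) (A B : 'End(U)) n u :
  (forall u, A (B u) = B (A u)) ->
  iter n (A + B) u = \sum_(i < n.+1) iter i A (iter (n - i) B u) *+ 'C(n, i).
Proof.
move=> AB; elim: n => [|n IHn]; first by rewrite big_ord1.
have ABi i v : B (iter i A v) = iter i A (B v).
  by elim: i v => //= i IHi v; rewrite -AB IHi.
rewrite iterS IHn add_lfunE !linear_sum /=.
under [X in X + _]eq_bigr do rewrite linearMn /= -iterS.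
under [X in _ + X]eq_bigr => i _ do rewrite linearMn /= ABi -iterS -subSn -1?ltnS ?ltn_ord //.
rewrite [RHS]big_ord_recl /= bin0 /bump /=.
under [X in _ = _ + X]eq_bigr do rewrite add1n binS mulrnDr subSS.
rewrite big_split /= addrA addrC -[in RHS]iterS; congr (_ + _).
rewrite big_ord_recl /= bin0; congr (_ + _).
rewrite [RHS]big_ord_recr /= bin_small // mulr0n addr0.
by apply: eq_bigr => i _; rewrite /bump /= add1n subSS.
Qed.

Lemma iter_lfunD_pchar (U : vectType F) (A B : 'End(U)) u :
  (forall u, A (B u) = B (A u)) -> iter p (A + B) u = iter p A u + iter p B u.
Proof.
move=> AB; rewrite iter_lfunD //; have p_pr := pcharf_prime charF.
have [q pq] : exists q, p = q.+1 by exists p.-1; rewrite prednK ?prime_gt0.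
have bin0F i : (0 < i < p)%N -> ('C(p, i)%:R : F) = 0.
  move=> /(prime_dvd_bin p_pr)/dvdnP[k ->].
  by rewrite natrM (pcharf0 charF) mulr0.
rewrite big_ord_recr /= subnn binn addrC; congr (_ + _).
move: bin0F; rewrite pq => bin0F; rewrite big_ord_recl bin0 subn0 /= big1 ?addr0 // => i _.
by rewrite -scaler_nat bin0F ?scale0r // /bump /= add1n ltnS.
Qed.

Lemma iterN_pchar (U : vectType F) (A : 'End(U)) u : iter p (- A) u = - iter p A u.
Proof.
have E n : iter n (- A) u = (-1) ^+ n *: iter n A u.
  elim: n => [|n IHn]; first by rewrite scale1r.
  by rewrite !iterS IHn opp_lfunE linearZ /= exprS mulN1r scaleNr.
by rewrite E -(pFrobenius_autE charF) pFrobenius_autN pFrobenius_aut1 scaleN1r.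
Qed.

Variable L : lieType F.

(** The operator is left multiplication by [sigma x] minus right multiplication by [rho x]; these
    commute, so the p-th power is taken termwise. *)
Lemma iter_homrep (V W : vectType F) (rho : lieRep L V) (sigma : lieRep L W) x f v :
  iter p (homrep rho sigma x) f v = iter p (sigma x) (f v) - f (iter p (rho x) v).
Proof.
have [A AE] : exists A : 'End('Hom(V, W)), forall f, A f = (sigma x \o f)%VF.
  by apply: linear_Hom => a g h; rewrite comp_lfunDr comp_lfunZr.
have [B BE] : exists B : 'End('Hom(V, W)), forall f, B f = (f \o rho x)%VF.
  by apply: linear_Hom => a g h; rewrite comp_lfunDl comp_lfunZl.
have eAB g : homrep rho sigma x g = (A + - B) g.
  by apply/lfunP => u; rewrite homrepE !(add_lfunE, opp_lfunE) AE BE !comp_lfunE.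
rewrite (eq_iter eAB) iter_lfunD_pchar ?iterN_pchar; last first.
  by move=> g; rewrite !opp_lfunE linearN /= !AE !BE comp_lfunA.
rewrite add_lfunE opp_lfunE; congr (_ - _).
  by elim: p => //= n IHn; rewrite AE comp_lfunE IHn.
suff h n u : iter n B f u = f (iter n (rho x) u) by [].
by elim: n u => //= n IHn u; rewrite BE comp_lfunE IHn -iterSr.
Qed.

Variable pmap : L -> L.

Definition restricted_rep (V : vectType F) (rho : lieRep L V) : Prop :=
  forall x v, iter p (rho x) v = rho (pmap x) v.

Lemma restricted_homrep (V W : vectType F) (rho : lieRep L V) (sigma : lieRep L W) :
  restricted_rep rho -> restricted_rep sigma -> restricted_rep (homrep rho sigma).
Proof.
by move=> rr rs x f; apply/lfunP => v; rewrite iter_homrep homrepE rr rs.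
Qed.

Lemma restricted_trivrep (V : vectType F) : restricted_rep (trivrep L V).
Proof.
have := prime_gt0 (pcharf_prime charF); rewrite /restricted_rep.
by case: p => // n _ x v; rewrite iterS !trivrepE.
Qed.

Lemma restricted_sumrep (V W : vectType F) (rho : lieRep L V) (sigma : lieRep L W) :
  restricted_rep rho -> restricted_rep sigma -> restricted_rep (sumrep rho sigma).
Proof.
move=> rr rs x u; rewrite sumrepE -rr -rs.
by elim: p => [|n /= ->]; [case: u | rewrite sumrepE].
Qed.

End PPowers.

(** * Modules of a p-envelope *)

Section Envelope.
Variables (F : fieldType) (p : nat) (S L : lieType F) (pmap : L -> L) (j : 'Hom(S, L)).
Hypothesis L_env : p_envelope p pmap j.

Let jM : lie_morphism j. Proof. by case: L_env. Qed.
Let ji : injective j. Proof. by case: L_env. Qed.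

Lemma iter_pmap k x y : lie (iter k pmap x) y = iter (p ^ k) (lie x) y.
Proof.
case: L_env => -[pmap_ad _ _] _ _ _.
elim: k x y => [|k IHk] x y //=.
rewrite pmap_ad expnS; elim: {1 2}p => //= n IHn.
by rewrite IHn IHk -iterD mulSn.
Qed.

(** Induction over the p-envelope: such a property cuts out a p-closed subalgebra containing [S],
    hence all of [L]. *)
Lemma subalgebra_env (P : L -> Prop) : P 0 -> (forall a x y, P x -> P y -> P (a *: x + y)) ->
  (forall x y, P x -> P y -> P (lie x y)) -> (forall x, P x -> P (pmap x)) ->
  (forall s, P (j s)) -> forall x, P x.
Proof.
case: L_env => _ _ _ gen P0 PD Pl Pp Ps x.
have [U UP] := vspace_of_pred P0 PD; apply/UP.
rewrite (gen U) ?memvf // => [u v /UP uP /UP vP|u /UP uP|s]; apply/UP; first exact: Pl.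
  exact: Pp.
exact: Ps.
Qed.

Lemma lie_env_img x s : lie x (j s) \in limg j.
Proof.
case: L_env => -[pmap_ad _ _] _ _ _; move: s; apply: (subalgebra_env (P := fun x => forall s, lie x (j s) \in limg j)).
- by move=> s; rewrite lie0l mem0v.
- by move=> a u v uP vP s; rewrite lieDl lieZl memvD ?memvZ.
- move=> u v uP vP s; have -> : lie (lie u v) (j s) = lie u (lie v (j s)) - lie v (lie u (j s)).
    by rewrite lie_leibniz addrK.
  have /memv_imgP[t _ ->] := vP s; have /memv_imgP[t' _ ->] := uP s.
  by rewrite memvB.
- move=> u uP s; rewrite pmap_ad; elim: p => [|n IHn] /=; first by rewrite memv_img ?memvf.
  by have /memv_imgP[t _ ->] := IHn.
- by move=> s' s; rewrite -jM memv_img ?memvf.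
Qed.

(** A p-th power acts by p nested brackets, the innermost of which already lies in [S] by induction;
    further brackets with [L] keep it there. *)
Lemma lie_env x y : (0 < p)%N -> lie x y \in limg j.
Proof.
case: L_env => -[pmap_ad _ _] _ _ _ p0; move: y; apply: (subalgebra_env (P := fun x => forall y, lie x y \in limg j)).
- by move=> s; rewrite lie0l mem0v.
- by move=> a u v uP vP s; rewrite lieDl lieZl memvD ?memvZ.
- move=> u v uP vP s; have /memv_imgP[t _ ->] := uP v.
  by rewrite lieC memvN lie_env_img.
- move=> u uP y; rewrite pmap_ad -(prednK p0) iterSr.
  have /memv_imgP[s _ ->] := uP y; elim: p.-1 => [|n IHn] /=; first by rewrite memv_img ?memvf.
  by have /memv_imgP[t _ ->] := IHn; rewrite lie_env_img.
- by move=> s y; rewrite lieC memvN lie_env_img.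
Qed.

(** [S] is an ideal of [L], so the bracket can be carried back to [S] along [j]. *)
Let ad_env_act (x : L) (s : S) : S := (j^-1)%VF (lie x (j s)).

Let j_ad_env_act x s : j (ad_env_act x s) = lie x (j s).
Proof. by rewrite limg_lfunVK ?lie_env_img. Qed.

Let ad_env_linearl s : linear (ad_env_act^~ s).
Proof. by move=> a x y; rewrite /ad_env_act lieDl lieZl linearP. Qed.
Let ad_env_linearr x : linear (ad_env_act x).
Proof. by move=> a s t; rewrite /ad_env_act !linearP. Qed.
Let ad_env_lie x y s :
  ad_env_act (lie x y) s = ad_env_act x (ad_env_act y s) - ad_env_act y (ad_env_act x s).
Proof. by apply: ji; rewrite linearB /= !j_ad_env_act lie_leibniz addrK. Qed.

Definition ad_env : lieRep L S := mkrep ad_env_linearl ad_env_linearr ad_env_lie.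

Lemma j_ad_env x s : j (ad_env x s) = lie x (j s).
Proof. by rewrite mkrepE j_ad_env_act. Qed.

Lemma ad_env_S s t : ad_env (j s) t = lie s t.
Proof. by apply: ji; rewrite j_ad_env jM. Qed.

Lemma restricted_ad_env : restricted_rep p pmap ad_env.
Proof.
case: L_env => -[pmap_ad _ _] _ _ _ x s; apply: ji; rewrite j_ad_env pmap_ad.
by elim: p => //= n <-; rewrite j_ad_env.
Qed.

Lemma ad_env_derivation x s t : ad_env x (lie s t) = lie (ad_env x s) t + lie s (ad_env x t).
Proof. by apply: ji; rewrite linearD /= !(j_ad_env, jM) lie_leibniz. Qed.

Lemma derived_submod_subproof n x v :
  v \in derived_series S n -> ad_env x v \in derived_series S n.
Proof. by apply: derivation_derived_series => s t; exact: ad_env_derivation. Qed.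

Definition derived_submod n : submod ad_env := Submod (@derived_submod_subproof n).

Definition derived_factor n := facrep (derived_submod n) (derived_submod n.+1).

End Envelope.

Section FactorModules.
Variables (F : fieldType) (L : lieType F) (V : vectType F) (rho : lieRep L V).
Variables (B A : submod rho).

Lemma facrepE x u : facrep B A x u = facpi B A (rho x (vsval u)).
Proof. by rewrite /= (linfunE_of (@facrep_fun_linear _ _ _ _ B A)) facrep_funE. Qed.

Lemma facrep_facpi x v : v \in B ->
  facrep B A x (facpi B A v) = facpi B A (rho x v).
Proof. by move=> vB; rewrite facrepE facpi_rho. Qed.

Lemma iter_facrep x n v : v \in B ->
  iter n (facrep B A x) (facpi B A v) = facpi B A (iter n (rho x) v).
Proof.
move=> vB; elim: n => //= n ->; rewrite facrep_facpi //.
by elim: n => //= n IHn; rewrite submodP.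
Qed.
End FactorModules.

(** * Admissible modules *)

Section Admissible.
Variables (F : fieldType) (p : nat).
Hypothesis charF : p \in [pchar F].
Variables (FF : lieType F -> Prop) (FF_form : formation FF) (FF_sat : saturated FF).
Variables (S : lieType F) (S_FF : FF S) (L : lieType F) (pmap : L -> L) (j : 'Hom(S, L)).
Hypothesis L_env : p_envelope p pmap j.

Let jM : lie_morphism j. Proof. by case: L_env. Qed.

Definition admissible (M : vectType F) (rho : lieRep L M) : Prop :=
  restricted_rep p pmap rho /\ FF (semidirect (pullrep jM rho)).

Lemma FF_split_eq (V : vectType F) (rho sigma : lieRep S V) :
  (forall s v, rho s v = sigma s v) -> FF (semidirect rho) -> FF (semidirect sigma).
Proof. by move=> e; apply: (FF_split_image FF_form (g := id)) => // s; exists s. Qed.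

Lemma admissible_sum (M N : vectType F) (rho : lieRep L M) (sigma : lieRep L N) :
  admissible rho -> admissible sigma -> admissible (sumrep rho sigma).
Proof.
move=> [rr Fr] [rs Fs]; split; first exact: restricted_sumrep.
apply: FF_split_eq (FF_split_sum FF_form Fr Fs) => s v.
by rewrite sumrepE !pullrepE sumrepE.
Qed.

(* [M (x) N] is modelled by [Hom(M^*, N)]. *)
Definition tensrep (M N : vectType F) (rho : lieRep L M) (sigma : lieRep L N) :=
  homrep (homrep rho (trivrep L F^o)) sigma.

Definition tens (M N : vectType F) (m : M) (n : N) : 'Hom('Hom(M, F^o), N) :=
  linfun (fun xi : 'Hom(M, F^o) => (xi m : F) *: n).

Lemma tensE (M N : vectType F) (m : M) (n : N) xi : tens m n xi = (xi m : F) *: n.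
Proof. by apply: linfunE_of => a u v; rewrite add_lfunE scale_lfunE scalerDl scalerA. Qed.

Lemma tens_linearl (M N : vectType F) (n : N) : linear (fun m : M => tens m n).
Proof.
move=> a u v; apply/lfunP => xi.
by rewrite add_lfunE scale_lfunE !tensE linearP scalerDl scalerA.
Qed.
Lemma tens_linearr (M N : vectType F) (m : M) : linear (fun n : N => tens m n).
Proof.
move=> a u v; apply/lfunP => xi.
by rewrite add_lfunE scale_lfunE !tensE scalerDr !scalerA mulrC.
Qed.

Lemma tensrepE (M N : vectType F) (rho : lieRep L M) (sigma : lieRep L N) x m n :
  tensrep rho sigma x (tens m n) = tens (rho x m) n + tens m (sigma x n).
Proof.
apply/lfunP => xi; rewrite add_lfunE homrepE !tensE homrepE trivrepE sub0r.
by rewrite scaleNr opprK linearZ addrC.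
Qed.

Lemma admissible_tens (M N : vectType F) (rho : lieRep L M) (sigma : lieRep L N) :
  admissible rho -> admissible sigma -> admissible (tensrep rho sigma).
Proof.
move=> [rr Fr] [rs Fs]; split.
  by do 2![apply: restricted_homrep => //]; apply: restricted_trivrep.
apply: (FF_split_bilinear FF_form FF_sat (@tens_linearl M N) (@tens_linearr M N)) Fr Fs.
  by move=> s m n; rewrite !pullrepE tensrepE.
move=> U tU; apply/eqP; rewrite eqEsubv subvf; apply/subvP => h _.
pose e := vbasis {:M}.
(* Pure tensors span: [h] is expanded along the basis e of [M] and its dual basis of coordinate
   forms. *)
have -> : h = \sum_(i < \dim {:M}) tens e`_i (h (linfun (coord e i : M -> F^o))).
  apply/lfunP => xi; rewrite sum_lfunE.
  under eq_bigr do rewrite tensE -linearZ.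
  rewrite -linear_sum; congr (h _); apply/lfunP => m.
  rewrite sum_lfunE {1}(coord_vbasis (memvf m)) linear_sum; apply: eq_bigr => i _.
  by rewrite scale_lfunE linearZ /= (linfunE_of (linearP _)) /=; exact: mulrC.
by apply: rpred_sum => i _; exact: tU.
Qed.

(** A nonzero soluble [K] has a nonzero abelian quotient by its derived algebra. As a trivial
    module, this quotient has for split extension its direct product with [S]. *)
Lemma admissible_triv (K : lieType F) (k : K) : FF K -> k != 0 ->
  exists (M : vectType F) (m : M), m != 0 /\ admissible (trivrep L M).
Proof.
move=> FFK k0.
have Did x a : a \in derived_series K 1 -> lie x a \in derived_series K 1.
  exact: derived_series_ideal.
pose D : ideal K := Ideal Did.
have [k1 k1D] : exists k1, k1 \notin D.
  apply: contrapT => /forallNP h.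
  have eD : derived_series K 1 = fullv.
    apply/eqP; rewrite eqEsubv subvf; apply/subvP => x _.
    by apply/negPn/negP; exact: (h x).
  have [n solK] := FF_soluble FF_form FFK.
  suff e n' : derived_series K n' = fullv.
    by move: (memvf k); rewrite -(e n) solK memv0 (negbTE k0).
  by elim: n' => //= n' ->.
have ab (u v : quotLie D) : lie u v = 0.
  rewrite -[u]quot_piK -[v]quot_piK -quot_pi_morphism; apply/eqP.
  by rewrite quot_pi_eq0 lieprodS ?memvf.
have FFD : FF (quotLie D) by case: FF_form => _ _ + _; apply.
exists (quotLie D), (quot_pi D k1); split; first by rewrite quot_pi_eq0.
split; first exact: restricted_trivrep.
set rho := pullrep _ _; have rho0 s v : rho s v = 0 by rewrite pullrepE trivrepE.
apply: (@FF_subdirect_fun _ _ FF_form (semidirect rho) S (quotLie D)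
  (fun x => x.2) (fun x => x.1)) => //.
- exact: sd_snd_surj.
- by move=> x y; rewrite sd_lieE /= ab !rho0 subrr.
- by move=> u; exists (u, 0).
- by move=> [u s] /= -> ->.
Qed.

(** The split extension is a subdirect product of [S] and of [S] modulo the derived term n+1, by (u,
    s) |-> s and (u, s) |-> u + s. The latter is a morphism because the factor is abelian. *)
Lemma admissible_derived_factor n : admissible (derived_factor L_env n).
Proof.
set B := derived_submod L_env n; set A := derived_submod L_env n.+1.
have vB (u : facv B A) : vsval u \in B by rewrite -[u]facpiK facpi_inB.
split.
  move=> x u; rewrite -[u]facpiK /derived_factor iter_facrep ?vB //.
  by rewrite facrep_facpi ?vB // restricted_ad_env.
pose A' : ideal S := Ideal (@derived_series_ideal F S n.+1).
set rho := pullrep _ _.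
have rhoE s u : rho s u = facpi B A (lie s (vsval u)).
  by rewrite pullrepE facrepE ad_env_S.
pose g (x : semidirect rho) : quotLie A' := quot_pi A' (vsval x.1 + x.2).
apply: (@FF_subdirect_fun _ _ FF_form (semidirect rho) S (quotLie A') (fun x => x.2) g) => //.
- exact: sd_snd_surj.
- by move=> a x y; rewrite /g -linearP /= scalerDr addrACA.
- move=> [u s] [v t]; rewrite /g sd_lieE /= -quot_pi_morphism; apply: quot_pi_eq.
  rewrite !rhoE lieDl !linearD /= (lieC (vsval u) t).
  have dA r (w : facv B A) : vsval (facpi B A (lie r (vsval w))) - lie r (vsval w) \in A.
    rewrite -opprB memvN facpi_sub // (subvP (addvSl _ _)) //.
    by apply: (@derived_series_ideal _ _ n); exact: vB.
  have mA : lie (vsval u) (vsval v) \in A by apply: lieprodS; exact: vB.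
  have eqA a b : a \in A -> a = b -> b \in A by move=> + <-.
  by apply: eqA (memvB (memvB (dA s v) (dA t u)) mA) _; zmodule.
- by move=> q; exists (0, vsval q); rewrite /g /= add0r quot_piK.
- move=> [u s] /= -> ; rewrite /g /= addr0 => /eqP; rewrite quot_pi_eq0 => uA.
  by congr (_, _); rewrite -[u]facpiK; apply/eqP; rewrite facpi_kerP ?vB.
by case: FF_form => _ _ + _; apply.
Qed.

(** Killing the derived factors, [x] moves each derived term into the next, so it is ad-nilpotent on
    [S], hence on [L] because [L, L] lies in [S]. A large iterated p-power is then central. *)
Lemma admissible_ker_nilpotent x :
  (forall z, center L z -> pmap z = 0) ->
  (forall (M : vectType F) (rho : lieRep L M), admissible rho -> rho x = 0) ->
  exists k, iter k pmap x = 0.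
Proof.
move=> L_center xker.
have [n solS] := FF_soluble FF_form S_FF.
have xD i s : s \in derived_series S i -> ad_env L_env x s \in derived_series S i.+1.
  move=> sD; have := congr1 (fun f : 'End(_) => f (facpi _ _ s)) (xker _ _ (admissible_derived_factor i)).
  rewrite zero_lfunE facrep_facpi // => /eqP.
  by rewrite facpi_kerP //; exact: (derived_submod_subproof L_env).
have xn i s : iter i (ad_env L_env x) s \in derived_series S i.
  by elim: i => [|i IHi] /=; [exact: memvf | exact: xD].
have xL y : iter n.+1 (lie x) y = 0.
  have /memv_imgP[s _ e] := lie_env L_env x y (prime_gt0 (pcharf_prime charF)).
  rewrite iterSr e.
  have -> : iter n (lie x) (j s) = j (iter n (ad_env L_env x) s).
    by elim: (n) => //= i ->; rewrite (j_ad_env L_env).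
  by have := xn n s; rewrite solS memv0 => /eqP->; rewrite linear0.
(* After n+1 p-powers the adjoint action is iterated p^(n+1) >= n+1 times, hence zero; the last
   p-power kills the central element reached. *)
exists n.+2; rewrite iterS; apply: L_center => y; rewrite (iter_pmap L_env).
have : (n.+1 <= p ^ n.+1)%N by rewrite ltnW // ltn_expl ?prime_gt1 ?(pcharf_prime charF).
move=> /subnK <-; rewrite iterD xL.
by elim: (_ - _)%N => //= i ->; rewrite linear0.
Qed.

End Admissible.

(** * Words, shuffles and PBW monomials *)

Section Words.
Variables (F : fieldType) (L : lieType F).

(** The head of the word acts first, so that matrix coefficients can be computed letter by letter
    from the left. *)
Definition wact (M : vectType F) (rho : lieRep L M) (w : seq L) (m : M) : M :=
  foldl (fun m x => rho x m) m w.

Arguments wact M rho w m : simpl never.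

Section WAct.
Variables (M : vectType F) (rho : lieRep L M).

Lemma wact_cons x w m : wact rho (x :: w) m = wact rho w (rho x m).
Proof. by []. Qed.

Lemma wact_cat u w m : wact rho (u ++ w) m = wact rho w (wact rho u m).
Proof. exact: foldl_cat. Qed.

Lemma wact_linear w : linear (wact rho w).
Proof.
by elim: w => //= x w IHw a u v; rewrite /wact /= linearP; exact: IHw.
Qed.

Lemma wact_sum w (I : finType) (c : I -> F) (f : I -> M) :
  wact rho w (\sum_i c i *: f i) = \sum_i c i *: wact rho w (f i).
Proof.
have [g gE] := linear_Hom (wact_linear w).
by rewrite -gE linear_sum; apply: eq_bigr => i _; rewrite linearZ /= gE.
Qed.

Lemma wactB w u v : wact rho w (u - v) = wact rho w u - wact rho w v.
Proof. by have [g gE] := linear_Hom (wact_linear w); rewrite -!gE linearB. Qed.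

End WAct.

(* Matrix coefficients, as functions on words in [L], turn tensor products of
  modules into shuffle products. *)
Fixpoint shuffle (f g : seq L -> F) (w : seq L) : F :=
  if w is x :: w' then
    shuffle (fun u => f (x :: u)) g w' + shuffle f (fun u => g (x :: u)) w'
  else f [::] * g [::].

Definition vanish_below (k : nat) (f : seq L -> F) := forall w, (size w < k)%N -> f w = 0.

Lemma vanish_cons k f x : vanish_below k f -> vanish_below k.-1 (fun u => f (x :: u)).
Proof. by move=> fk w wk; apply: fk; case: k wk. Qed.

(** Each summand splits the word between [f] and [g], and one of the two parts is too short. *)
Lemma shuffle_vanish a b f g :
  vanish_below a f -> vanish_below b g -> vanish_below (a + b) (shuffle f g).
Proof.
move=> fa gb w; elim: w a b f g fa gb => [|x w IHw] a b f g fa gb /=.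
  rewrite addn_gt0 => /orP[a0|b0]; first by rewrite fa ?mul0r.
  by rewrite gb ?mulr0.
move=> wab; rewrite (IHw a.-1 b _ _ (vanish_cons x fa) gb); last first.
  by case: a wab {fa} => [|a] // /ltnW.
rewrite (IHw a b.-1 _ _ fa (vanish_cons x gb)) ?addr0 //.
by case: b wab {gb} => [|b]; rewrite ?addnS ?addn0 // => /ltnW.
Qed.

Lemma eq_shuffle f f' g g' w : f =1 f' -> g =1 g' -> shuffle f g w = shuffle f' g' w.
Proof.
elim: w f f' g g' => [|x w IHw] f f' g g' ef eg /=; first by rewrite ef eg.
by congr (_ + _); apply: IHw => // u; rewrite ?ef ?eg.
Qed.

Definition word_unit (w : seq L) : F := (size w == 0%N)%:R.

(** [word_unit] is neutral for the shuffle product. *)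
Lemma shuffle_scale_unitD c f g w :
  shuffle (fun u => c * word_unit u + f u) g w = c * g w + shuffle f g w.
Proof.
have sh0 (f' g' : seq L -> F) u : (forall v, f' v = 0) -> shuffle f' g' u = 0.
  elim: u f' g' => [|x u IHu] f' g' f0 /=; first by rewrite f0 mul0r.
  by rewrite !IHu ?addr0.
have shD (h f' g' : seq L -> F) u :
    shuffle (fun v => h v + f' v) g' u = shuffle h g' u + shuffle f' g' u.
  elim: u h f' g' => [|x u IHu] h f' g' /=; first by rewrite mulrDl.
  by rewrite !IHu addrACA.
rewrite shD; congr (_ + _); elim: w g => [|x w IHw] g /=; first by rewrite mulr1.
rewrite IHw sh0 ?add0r // => v; exact: mulr0.
Qed.

Section DualBasis.
Variables (n : nat) (xs : 'I_n -> L) (Y : 'I_n -> seq L -> F).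
Hypothesis Y0 : forall i, Y i [::] = 0.
Hypothesis Yx : forall i k, Y i [:: xs k] = (i == k)%:R.

(** A monomial in the coordinate functions [Y i] for the shuffle product, to be paired with words in
    the [xs]. *)
Definition wmon (w : seq 'I_n) : seq L -> F :=
  foldr (fun i f => shuffle (Y i) f) word_unit w.

Lemma wmon_vanish w : vanish_below (size w) (wmon w).
Proof.
elim: w => [|i w IHw] //; rewrite -[size _]/(1 + size w)%N.
by apply: shuffle_vanish IHw; case.
Qed.

(** On words of length b+1 only the splittings giving one letter to [Y i] and b letters to [f]
    survive. Each occurrence of i contributes one, and they agree because [g] is symmetric. *)
Lemma shuffle_dual i f b (g : seq 'I_n -> F) u :
  vanish_below b f -> {homo g : v w / perm_eq v w >-> v = w} ->
  (forall u, size u = b -> f (map xs u) = g u) -> size u = b.+1 ->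
  shuffle (Y i) f (map xs u) = (count_mem i u)%:R * g (rem i u).
Proof.
elim: u b f g => [|k u IHu] // b f g fb gperm fg [su] /=.
have -> : shuffle (fun v => Y i (xs k :: v)) f (map xs u) = (i == k)%:R * g u.
  rewrite -(fg _ su).
  (* [h] collects the cases where [Y i] takes further letters; they leave fewer than b letters to
     [f]. *)
  pose h v := Y i (xs k :: v) - (i == k)%:R * word_unit v.
  rewrite (@eq_shuffle _ (fun v => (i == k)%:R * word_unit v + h v) f f) // => [|v].
    rewrite shuffle_scale_unitD (@shuffle_vanish 1 b h f) ?addr0 ?size_map ?su //.
    by case=> // _; rewrite /h Yx mulr1 subrr.
  by rewrite /h addrC subrK.
have -> : shuffle (Y i) (fun v => f (xs k :: v)) (map xs u) =
    (count_mem i u)%:R * g (k :: rem i u).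
  case: b su fb fg => [|b] su fb fg.
    by move/size0nil: su => -> /=; rewrite Y0 !mul0r.
  rewrite (IHu b _ (fun v => g (k :: v))) //.
  - exact: (@vanish_cons b.+1).
  - by move=> v w vw; apply: gperm; rewrite perm_cons.
  - by move=> v sv; rewrite -fg //= sv.
rewrite [i == k]eq_sym; case: eqP => [->|_] /=; last by rewrite mul0r add0r.
rewrite mul1r natrD mulrDl mul1r; congr (_ + _).
have [ku|ku] := boolP (i \in u); last by rewrite (count_memPn ku) !mul0r.
by congr (_ * _); apply: gperm; rewrite perm_sym; exact: perm_to_rem.
Qed.

(** For words of equal length: the product of the factorials of the multiplicities if they are
    permutations of each other, and 0 otherwise. *)
Fixpoint wpair (w u : seq 'I_n) : F :=
  if w is i :: w' then (count_mem i u)%:R * wpair w' (rem i u) else (u == [::])%:R.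

Lemma wpair_perm w : {homo wpair w : u v / perm_eq u v >-> u = v}.
Proof.
elim: w => [|i w IHw] u v uv /=; first by rewrite -!size_eq0 (perm_size uv).
rewrite (permP uv) (IHw _ (rem i v)) //.
have [iu|iu] := boolP (i \in u); last first.
  by rewrite !rem_id // -(perm_mem uv).
have iv : i \in v by rewrite -(perm_mem uv).
by rewrite -(perm_cons i) -(permPl (perm_to_rem iu)) -(permPr (perm_to_rem iv)).
Qed.

Lemma wmon_wpair w u : size u = size w -> wmon w (map xs u) = wpair w u.
Proof.
elim: w u => [|i w IHw] u su /=; first by rewrite /word_unit size_map size_eq0.
by apply: shuffle_dual su => //; [exact: wmon_vanish | exact: wpair_perm].
Qed.

Lemma wpair_eq0 w u : size u = size w -> ~~ perm_eq w u -> wpair w u = 0.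
Proof.
elim: w u => [|i w IHw] u su /=; first by move/size0nil: su => ->.
have [iu|iu _] := boolP (i \in u); last by rewrite (count_memPn iu) mul0r.
rewrite (permPr (perm_to_rem iu)) perm_cons => /IHw-> //; first by rewrite mulr0.
by rewrite size_rem // su.
Qed.

(** Every factor is a multiplicity between 1 and p - 1. *)
Lemma wpair_neq0 p w u : p \in [pchar F] -> perm_eq w u ->
  (forall i, (count_mem i u < p)%N) -> wpair w u != 0.
Proof.
move=> charF; elim: w u => [|i w IHw] u wu up /=.
  by move: wu => /perm_size /esym/size0nil ->; rewrite oner_eq0.
have iu : i \in u by rewrite -(perm_mem wu) mem_head.
rewrite mulf_neq0 //.
  rewrite -(dvdn_pcharf charF) gtnNdvd ?up // -has_count has_pred1 //.
apply: IHw => [|k]; first by move: wu; rewrite (permPr (perm_to_rem iu)) perm_cons.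
apply: leq_ltn_trans (up k); rewrite (permP (perm_to_rem iu)) /=; exact: leq_addl.
Qed.

Section BoxWords.
Variable p : nat.
Hypothesis charF : p \in [pchar F].

(* The words of the PBW monomials [x_1^a_1 ... x_n^a_n], [a_i < p]. *)
Definition box_word (a : {ffun 'I_n -> 'I_p}) : seq 'I_n :=
  flatten [seq nseq (a i) i | i <- enum 'I_n].

Lemma count_box_word a i : count_mem i (box_word a) = a i.
Proof.
rewrite /box_word count_flatten -map_comp sumnE big_map big_enum /=.
rewrite (bigD1 i) //= count_nseq /= eqxx mul1n big1 ?addn0 // => k ki.
by rewrite count_nseq /= (negbTE ki).
Qed.

Lemma box_word_inj a b : perm_eq (box_word a) (box_word b) -> a = b.
Proof.
by move=> ab; apply/ffunP => i; apply: val_inj; rewrite /= -!count_box_word (permP ab).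
Qed.

Lemma perm_box_word w : (forall i, (count_mem i w < p)%N) ->
  exists a, perm_eq w (box_word a).
Proof.
move=> wp; exists [ffun i => Ordinal (wp i)].
by apply/allP => i _ /=; rewrite count_box_word ffunE.
Qed.

(** Take a longest monomial with nonzero coefficient and apply its dual form: shorter words are
    killed by vanishing, the others of the same length by the pairing. *)
Lemma box_word_independent (M : vectType F) (rho : lieRep L M) (m : M) c :
  (forall a, exists xi : 'Hom(M, F^o), forall w, wmon (box_word a) w = xi (wact rho w m)) ->
  \sum_a c a *: wact rho (map xs (box_word a)) m = 0 -> forall a, c a = 0.
Proof.
move=> xiP sum0 a0; apply/eqP; apply: contraT => ca0.
case: (@arg_maxnP _ a0 (fun a => c a != 0) (fun a => size (box_word a)) ca0) => a ca maxa.
have [xi xiE] := xiP a.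
have := congr1 xi sum0; rewrite linear0 linear_sum (bigD1 a) //= linearZ /= -xiE big1.
  move=> /eqP; rewrite addr0 wmon_wpair // scaler_eq0 (negbTE ca) /=.
  have cb i : (count_mem i (box_word a) < p)%N by rewrite count_box_word ltn_ord.
  by rewrite (negbTE (wpair_neq0 charF (perm_refl _) cb)).
move=> b ba; rewrite linearZ /= -xiE; have [->|cb] := eqVneq (c b) 0; first exact: scale0r.
have /= := maxa b cb; rewrite leq_eqVlt => /orP[/eqP sb|sb].
  rewrite wmon_wpair // wpair_eq0 ?scaler0 //.
  by apply: contra ba => /box_word_inj ->.
by rewrite wmon_vanish ?size_map // scaler0.
Qed.

End BoxWords.
End DualBasis.
End Words.
Arguments wact {F L M} rho w m : simpl never.

(** * Engel's theorem and PBW spanning *)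

Section Engel.
Variables (F : fieldType) (L : lieType F).

Definition adrep : lieRep L L.
Proof.
refine (@mkrep F L L (@lie F L) (@lie_linearl F L) (@lie_linearr F L) _).
by move=> x y z; rewrite lie_leibniz addrK.
Defined.

Lemma adrepE x y : adrep x y = lie x y. Proof. exact: mkrepE. Qed.

Definition stable_under (V : vectType F) (rho : lieRep L V) (Q : {vspace L}) (A : {vspace V}) :=
  forall x v, x \in Q -> v \in A -> rho x v \in A.

(* Stated for subquotients [B / A], so that it applies to [R / Q] as well. *)
Definition engel_property (Q : {vspace L}) : Prop :=
  forall (V : vectType F) (rho : lieRep L V) (A B : {vspace V}),
  stable_under rho Q A -> stable_under rho Q B -> ~~ (B <= A)%VS ->
  (forall x v, x \in Q -> v \in B -> exists k, iter k (rho x) v \in A) ->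
  exists v, [/\ v \in B, v \notin A & forall x, x \in Q -> rho x v \in A].

(** A vector sent into [A] by [Q] keeps this property under y because [Q, y] lies in [Q]; its last
    iterate outside [A] is sent into [A] by y as well. *)
Lemma engel_add_line (Q : {vspace L}) y : engel_property Q ->
  (forall x, x \in Q -> lie x y \in Q) -> engel_property (Q + <[y]>)%VS.
Proof.
move=> EQ Qy V rho A B sA sB BA nilp.
have QQ' x : x \in Q -> x \in (Q + <[y]>)%VS by apply: subvP; exact: addvSl.
have yQ' : y \in (Q + <[y]>)%VS by apply: subvP (memv_line y); exact: addvSr.
have [|||v0 [v0B v0A Qv0]] := EQ V rho A B _ _ BA.
- by move=> x v /QQ'; exact: sA.
- by move=> x v /QQ'; exact: sB.
- by move=> x v /QQ'; exact: nilp.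
have yv k : iter k (rho y) v0 \in B /\ forall x, x \in Q -> rho x (iter k (rho y) v0) \in A.
  elim: k => //= k [kB kA]; split; first exact: sB.
  move=> x xQ; set w := iter _ _ _ in kB kA *.
  have -> : rho x (rho y w) = rho (lie x y) w + rho y (rho x w) by rewrite lrepP subrK.
  by apply: memvD; [apply: kA; exact: Qy | apply: sA => //; exact: kA].
case: (ex_minnP (nilp y v0 yQ' v0B)) => -[|k] kA mink; first by rewrite kA in v0A.
have [kB Qk] := yv k; exists (iter k (rho y) v0); split => //.
  by apply/negP => /mink; rewrite ltnn.
move=> x /mem_add_line[u [a [uQ ->]]].
by rewrite addrC lrepPl memvD ?memvZ // ?Qk.
Qed.

(** Let [Q] be maximal among the subalgebras of [R] with the property. If it is proper, the property
    applied to R / Q under the adjoint action gives y outside [Q] normalising it, and [Q] can be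
    enlarged by y. *)
Lemma engel (R : {vspace L}) : subalgebra R ->
  (forall x y, x \in R -> exists k, iter k (lie x) y = 0) -> engel_property R.
Proof.
move=> sR nilR.
have [|Q [sQ QR EQ] maxQ] := @ex_max_vspace _ L
    (fun Q => [/\ subalgebra Q, (Q <= R)%VS & engel_property Q]).
  exists 0%VS; split; first by move=> x y; rewrite !memv0 => /eqP-> _; rewrite lie0l.
    exact: sub0v.
  move=> V rho A B _ _ /subvPn[v vB vA] _; exists v; split=> // x.
  by rewrite memv0 => /eqP->; rewrite linear0 zero_lfunE mem0v.
have [/eqP eQR|QneR] := boolP (Q == R); first by rewrite -eQR.
have RQ : ~~ (R <= Q)%VS by move: QneR; rewrite eqEsubv QR.
have [|||y [yR yQ Qy]] := EQ L adrep Q R _ _ RQ.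
- by move=> x v; rewrite adrepE; exact: sQ.
- by move=> x v /(subvP QR) xR; rewrite adrepE; exact: sR.
- move=> x v /(subvP QR) xR _; have [k e] := nilR x v xR; exists k.
  by rewrite (eq_iter (adrepE x)) e mem0v.
case: (add_line_neq yQ); apply: maxQ (addvSl _ _).
have Qy' x : x \in Q -> lie x y \in Q by move=> /Qy; rewrite adrepE.
split; last exact: engel_add_line.
  move=> x x' /mem_add_line[u [a [uQ ->]]] /mem_add_line[u' [a' [uQ' ->]]].
  apply: (subvP (addvSl _ _)); rewrite lieDl !linearD /= !lieZl !linearZ /= liexx.
  rewrite !scaler0 addr0 (lieC y) scalerN.
  by apply: memvB; [apply: memvD; [exact: sQ|]|]; apply: memvZ; exact: Qy'.
by rewrite subv_add QR; apply/subvP => _ /vlineP[a ->]; exact: memvZ.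
Qed.

End Engel.

Section PBW.
Variables (F : fieldType) (p : nat) (L : lieType F) (pmap : L -> L).
Hypothesis charF : p \in [pchar F].
Variables (M : vectType F) (rho : lieRep L M) (G : M -> Prop).
Hypothesis G_stable : forall x m, G m -> G (rho x m).
Hypothesis G_restricted : forall x m, G m -> iter p (rho x) m = rho (pmap x) m.
Variables (n : nat) (xs : 'I_n -> L).
Hypothesis G_span : forall x, exists c : 'I_n -> F, forall m, G m ->
  rho x m = \sum_i c i *: rho (xs i) m.
Variables (B : {vspace M}) (m0 : M).
Hypothesis Gm0 : G m0.

Let act (w : seq 'I_n) : M := wact rho (map xs w) m0.

Let act_G (w : seq L) : G (wact rho w m0).
Proof.
elim/last_ind: w => [|w x IHw] //.
by rewrite -cats1 wact_cat; exact: G_stable.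
Qed.

(** On vectors of [G] an arbitrary letter of [L] is a combination of the [xs]. *)
Let act_mid u x w : (forall v, (size v <= (size u + size w).+1)%N -> act v \in B) ->
  wact rho (map xs u ++ x :: map xs w) m0 \in B.
Proof.
move=> IH; have [c cE] := G_span x.
rewrite wact_cat wact_cons.
rewrite cE ?act_G // wact_sum rpred_sum // => i _; rewrite rpredZ //.
have := IH (u ++ i :: w); rewrite /act map_cat wact_cat; apply.
by rewrite size_cat /= addnS.
Qed.

Section Straightening.
Variable d : nat.
Hypothesis IHd : forall w, (size w < d)%N -> act w \in B.

(** Swapping neighbours costs their bracket, a single letter, hence shorter words. *)
Let act_swap u i k w : size (u ++ i :: k :: w) = d ->
  act (u ++ i :: k :: w) - act (u ++ k :: i :: w) \in B.
Proof.
rewrite size_cat /= => sd; rewrite /act !map_cat !wact_cat /= !wact_cons -wactB -lrepP.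
have := @act_mid u (lie (xs k) (xs i)) w; rewrite wact_cat wact_cons; apply => v sv.
by apply: IHd; rewrite -sd !addnS ltnS.
Qed.

Let act_front u w i v : size (u ++ w ++ i :: v) = d ->
  act (u ++ w ++ i :: v) - act (u ++ i :: w ++ v) \in B.
Proof.
elim: w u => [|k w IHw] u sd; first by rewrite subrr mem0v.
have h1 := IHw (rcons u k); rewrite !cat_rcons in h1; move/(_ sd): h1 => h1.
have /= h2 := @act_swap u k i (w ++ v).
have := memvD h1 (h2 _); rewrite addrA subrK; apply.
by rewrite -sd !size_cat /= !size_cat /= !addnS.
Qed.

Lemma act_perm u w w' : perm_eq w w' -> size (u ++ w) = d ->
  act (u ++ w) - act (u ++ w') \in B.
Proof.
elim: w u w' => [|i w IHw] u w' ww' sd.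
  by move: ww' => /perm_size/esym/size0nil ->; rewrite subrr mem0v.
have iw' : i \in w' by rewrite -(perm_mem ww') mem_head.
have [s1 [s2 e]] : exists s1 s2, w' = s1 ++ i :: s2 by case/splitPr: iw' => s1 s2; exists s1, s2.
move: ww' sd; rewrite e => ww' sd.
have ww2 : perm_eq w (s1 ++ s2).
  by move: ww'; rewrite perm_sym perm_catC /= perm_sym perm_cons perm_sym perm_catC perm_sym.
have sd' : size (u ++ s1 ++ i :: s2) = d by rewrite -sd !size_cat (perm_size ww') size_cat.
have h1 := act_front sd'.
have h2 := IHw (rcons u i) _ ww2; rewrite !cat_rcons in h2.
by have := memvB (h2 sd) h1; rewrite opprB addrA subrK.
Qed.

End Straightening.

Hypothesis B_box : forall a : {ffun 'I_n -> 'I_p}, act (box_word a) \in B.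

(** Induction on the length. Words may be reordered modulo shorter ones; a letter x occurring p
    times is brought to the front, where its p-th power becomes the single letter x^[p]. *)
Lemma pbw_span w : act w \in B.
Proof.
have p_pr := pcharf_prime charF.
have [d] := ubnP (size w); elim: d w => // d IHd w; rewrite ltnS leq_eqVlt.
case/orP=> [/eqP sd|]; last exact: IHd.
have perm w' : perm_eq w w' -> act w' \in B -> act w \in B.
  move=> ww' w'B; have := memvD (act_perm IHd (u := [::]) ww' sd) w'B.
  by rewrite subrK.
have [/forallP wp|/forallPn[i]] := boolP [forall i, (count_mem i w < p)%N].
  by have [a /perm] := perm_box_word wp; apply.
rewrite -leqNgt => pi.
have [v wv] : exists v, perm_eq w (nseq p i ++ v).
  exists (nseq (count_mem i w - p) i ++ filter (predC (pred1 i)) w).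
  have e : filter (pred1 i) w = nseq (count_mem i w) i.
    by rewrite -size_filter; apply/all_pred1P; exact: filter_all.
  by rewrite catA -nseqD subnKC // -e perm_sym perm_filterC.
apply: (perm _ wv); rewrite /act map_cat map_nseq wact_cat.
have -> : wact rho (nseq p (xs i)) m0 = rho (pmap (xs i)) m0.
  rewrite -G_restricted //; elim: (p) m0 => //= q IHq m.
  by rewrite wact_cons IHq -iterSr.
have := @act_mid [::] (pmap (xs i)) v; apply => u su; apply: IHd.
apply: leq_ltn_trans su _; rewrite -sd (perm_size wv) size_cat size_nseq.
by rewrite -[X in (X < _)%N]add1n ltn_add2r prime_gt1.
Qed.

End PBW.

(** * Characters *)

Section BaseChangeEnd.
Variables (F E : fieldType) (iota : {rmorphism F -> E}) (V : vectType F).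
Local Notation bV := (bchange iota V).

Definition bc_end (a : 'End(V)) : 'End(bV) :=
  linfun (fun u : bV => \sum_i (u : 'rV_ _) 0 i *: bc iota (a (bc_basis i)) : bV).

Lemma bc_end_bc a v : bc_end a (bc iota v) = bc iota (a v).
Proof.
rewrite /bc_end linfunE_of => [|k u w].
  rewrite {2}[v]bc_basisE linear_sum bc_sum; apply: eq_bigr => i _.
  by rewrite linearZ bcZ mxE.
rewrite scaler_sumr -big_split; apply: eq_bigr => i _ /=.
by rewrite !mxE scalerDl scalerA.
Qed.

Lemma bc_linear_eq (M : vectType E) (f g : 'Hom(bV, M)) :
  (forall v, f (bc iota v) = g (bc iota v)) -> forall u, f u = g u.
Proof.
move=> fg; apply: bc_ind => [|a u v fu fv|//]; first by rewrite !linear0.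
rewrite [LHS](linearP f) [RHS](linearP g). by congr (_ *: _ + _).
Qed.

Lemma bc_endP k a b u : bc_end (k *: a + b) u = iota k *: bc_end a u + bc_end b u.
Proof.
have -> : iota k *: bc_end a u + bc_end b u = (iota k *: bc_end a + bc_end b) u.
  by rewrite add_lfunE scale_lfunE.
apply: bc_linear_eq u => v; rewrite add_lfunE scale_lfunE !bc_end_bc.
by rewrite add_lfunE scale_lfunE bcD bcZ.
Qed.

Lemma bc_end_comp a b u : bc_end (a \o b)%VF u = bc_end a (bc_end b u).
Proof.
rewrite -comp_lfunE; apply: bc_linear_eq u => v.
by rewrite comp_lfunE !bc_end_bc comp_lfunE.
Qed.

Lemma bc_end1 u : bc_end \1%VF u = u.
Proof.
rewrite -[RHS](id_lfunE u); apply: bc_linear_eq u => v.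
by rewrite bc_end_bc !id_lfunE.
Qed.

Lemma bc_end0 u : bc_end 0 u = 0.
Proof.
rewrite -[RHS](zero_lfunE _ u); apply: bc_linear_eq u => v.
by rewrite bc_end_bc !zero_lfunE bc0.
Qed.

End BaseChangeEnd.

Section Irreducible.
Variables (F : fieldType) (L : lieType F) (V : vectType F) (rho : lieRep L V).
Hypothesis V_irr : irreducible rho.

Lemma irreducible_nz : exists v : V, v != 0.
Proof.
case: V_irr => V0 _; exists (vpick {:V}).
by rewrite vpick0; apply/eqP.
Qed.

Lemma irreducible_stable (U : {vspace V}) :
  (forall x v, v \in U -> rho x v \in U) -> U = 0%VS \/ U = fullv.
Proof. by case: V_irr => _ h sU; apply: (h (Submod sU)). Qed.

Lemma schur_inj (a : 'End(V)) : (forall x v, a (rho x v) = rho x (a v)) ->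
  a != 0 -> lker a == 0%VS.
Proof.
move=> aC a0; have [|->//|e] := @irreducible_stable (lker a).
  by move=> x v; rewrite !memv_ker aC => /eqP->; rewrite linear0.
case/eqP: a0; apply/lfunP => v; rewrite zero_lfunE; apply/eqP.
by rewrite -memv_ker e memvf.
Qed.

End Irreducible.

(** By dimension, an injective endomorphism preserving [G] maps it onto itself. *)
Lemma inj_stable_mem (F : fieldType) (V : vectType F) (a : 'End(V)) (G : {vspace V}) t :
  lker a == 0%VS -> (forall g, g \in G -> a g \in G) -> a t \in G -> t \in G.
Proof.
move=> a0 aG; have eG : (a @: G)%VS = G.
  apply/eqP; rewrite eqEdim limg_dim_eq ?(eqP a0) ?capv0 // leqnn andbT.
  by apply/subvP => _ /memv_imgP[g gG ->]; exact: aG.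
by rewrite -{1}eG => /memv_imgP[g gG /(lker0P a0) ->].
Qed.

Section PCharacter.
Variables (F : fieldType) (p : nat) (L : lieType F) (pmap : L -> L).
Hypothesis charF : p \in [pchar F].
Hypothesis pmap_ad : forall x y, lie (pmap x) y = iter p (lie x) y.

Section PDefect.
Variables (V : vectType F) (rho : lieRep L V).

(** The action of x^p - x^[p], a central element of the enveloping algebra. *)
Definition pdefect (x : L) : 'End(V) :=
  linfun (fun v => iter p (rho x) v - rho (pmap x) v).

Lemma pdefectE x v : pdefect x v = iter p (rho x) v - rho (pmap x) v.
Proof.
apply: linfunE_of => a u w; rewrite linearP.
have -> : iter p (rho x) (a *: u + w) = a *: iter p (rho x) u + iter p (rho x) w.
  by elim: p => //= n ->; rewrite linearP.
by rewrite scalerBr; zmodule.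
Qed.

(** The p-th power formula on End(V), applied to [rho y], identifies the commutator of x^p and y
    with the action of (ad x)^p y = [x^[p], y]. *)
Lemma pdefect_comm x y v : pdefect x (rho y v) = rho y (pdefect x v).
Proof.
rewrite !pdefectE linearB /=.
have := @iter_homrep F p charF L V V rho rho x (rho y) v.
have -> : iter p (homrep rho rho x) (rho y) = rho (lie (pmap x) y).
  rewrite pmap_ad; elim: p => //= n ->; apply/lfunP => u.
  by rewrite homrepE lrepP.
rewrite lrepP => e; apply/eqP; rewrite -subr_eq0; apply/eqP.
rewrite -[RHS](subrr (rho (pmap x) (rho y v) - rho y (rho (pmap x) v))) {1}e.
by zmodule.
Qed.

End PDefect.
End PCharacter.

(** * Intertwiners from a common character *)

Section CommonCharacter.
Variables (F E : fieldType) (iota : {rmorphism F -> E}) (p : nat).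
Variables (L : lieType F) (pmap : L -> L).
Hypothesis charF : p \in [pchar F].
Hypothesis pmap_ad : forall x y, lie (pmap x) y = iter p (lie x) y.

(** The scalar action on the subquotient B / A, stated without forming the quotient. *)
Definition scalar_on (V : vectType F) (A B : {vspace (bchange iota V)}) (a : 'End(V)) (l : E) :=
  forall u, u \in B -> bc_end iota a u - l *: u \in A.

Section ScalarOn.
Variables (V : vectType F) (A B : {vspace (bchange iota V)}).
Hypothesis AB : (A <= B)%VS.

Lemma scalar_onP k a b l m : scalar_on A B a l -> scalar_on A B b m ->
  scalar_on A B (k *: a + b) (iota k * l + m).
Proof.
move=> al bm u uB; have := memvD (memvZ (iota k) (al u uB)) (bm u uB).
rewrite bc_endP scalerDl scalerBr scalerA => h.
have eqA s t : s \in A -> s = t -> t \in A by move=> + <-.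
by apply: eqA h _; zmodule.
Qed.

Lemma scalar_on_comp a b l m : scalar_on A B a l -> scalar_on A B b m ->
  scalar_on A B (a \o b)%VF (l * m).
Proof.
move=> al bm u uB.
have buB : bc_end iota b u \in B.
  by rewrite -[bc_end _ _ _](subrK (m *: u)) memvD ?memvZ // (subvP AB) ?bm.
have := memvD (al _ buB) (memvZ l (bm u uB)).
by rewrite bc_end_comp scalerBr scalerA addrA subrK.
Qed.

Lemma scalar_on1 : scalar_on A B \1%VF 1.
Proof. by move=> u _; rewrite bc_end1 scale1r subrr mem0v. Qed.

Lemma scalar_on0 l : ~~ (B <= A)%VS -> scalar_on A B 0 l -> l = 0.
Proof.
move=> /subvPn[u uB uA] h; apply/eqP; apply: contraNT uA => l0.
have := h u uB; rewrite bc_end0 sub0r memvN => luA.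
by rewrite -[u](scalerK l0) memvZ.
Qed.

(** If [a] were injective, so would be its base change, which maps [B] into [A]; the dimensions
    would then force A = B. *)
Lemma scalar_on_inj a : ~~ (B <= A)%VS -> scalar_on A B a 0 -> lker a != 0%VS.
Proof.
move=> BA h; apply: contra BA => /eqP a0.
have ak : lker (bc_end iota a) == 0%VS.
  apply/lker0P; apply: (can_inj (g := bc_end iota a^-1%VF)) => u.
  by rewrite -bc_end_comp lker0_compVf ?bc_end1 ?a0.
have sBA : (bc_end iota a @: B <= A)%VS.
  by apply/subvP => _ /memv_imgP[u uB ->]; have := h u uB; rewrite scale0r subr0.
have := dimvS sBA; rewrite limg_dim_eq ?(eqP ak) ?capv0 // => dBA.
by have /eqP <- : A == B by rewrite eqEdim AB.
Qed.

Lemma bc_end_pdefect (rho : lieRep L V) x u :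
  bc_end iota (pdefect p pmap rho x) u =
  iter p (bc_rep iota rho (bc iota x)) u - bc_rep iota rho (bc iota (pmap x)) u.
Proof.
have [g gE] : exists g : 'End(bchange iota V), forall u,
    g u = iter p (bc_rep iota rho (bc iota x)) u - bc_rep iota rho (bc iota (pmap x)) u.
  apply: linear_Hom => a v w; rewrite linearP.
  have -> : iter p (bc_rep iota rho (bc iota x)) (a *: v + w) =
      a *: iter p (bc_rep iota rho (bc iota x)) v + iter p (bc_rep iota rho (bc iota x)) w.
    by elim: p => //= n ->; rewrite linearP.
  by rewrite scalerBr; zmodule.
rewrite -gE; apply: bc_linear_eq u => v; rewrite bc_end_bc gE pdefectE.
have -> : iter p (bc_rep iota rho (bc iota x)) (bc iota v) = bc iota (iter p (rho x) v).
  by elim: p => // n; rewrite !iterS => ->; rewrite bc_repE.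
by rewrite bc_repE -scaleN1r bcD bcZ rmorphN1 scaleN1r.
Qed.

End ScalarOn.

Lemma has_character_scalar_on (V : vectType F) (rho : lieRep L V)
    (B A : submod (bc_rep iota rho)) c x :
  has_character p pmap (facrep B A) c ->
  scalar_on A B (pdefect p pmap rho x) (c x ^+ p).
Proof.
move=> hc u uB; have := hc x (facpi B A u).
rewrite iter_facrep // facrep_facpi // bc_end_pdefect => /eqP.
rewrite -subr_eq0 -linearZ -!linearB facpi_kerP //.
have iB n : iter n (bc_rep iota rho (bc iota x)) u \in B.
  by elim: n => // n IHn; rewrite iterS; exact: submodP.
by apply: memvB; [apply: memvB; [exact: iB | exact: submodP] | exact: memvZ].
Qed.

Lemma irreducible_facrep_proper (K : fieldType) (M : lieType K) (V : vectType K)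
    (rho : lieRep M V) (B A : submod rho) :
  irreducible (facrep B A) -> ~~ (B <= A)%VS.
Proof.
move=> /irreducible_nz[u u0]; apply: contra u0 => BA.
have uB : vsval u \in B by rewrite -[u]facpiK facpi_inB.
by rewrite -[u]facpiK facpi_kerP // (subvP BA).
Qed.

Section Intertwiner.
Variables (V W : vectType F) (rV : lieRep L V) (rW : lieRep L W).
Hypotheses (V_irr : irreducible rV) (W_irr : irreducible rW).
Variables (AV BV : {vspace (bchange iota V)}) (AW BW : {vspace (bchange iota W)}).
Hypotheses (ABV : (AV <= BV)%VS) (BAV : ~~ (BV <= AV)%VS).
Hypotheses (ABW : (AW <= BW)%VS) (BAW : ~~ (BW <= AW)%VS).
Variable c : L -> E.
Hypothesis cV : forall x, scalar_on AV BV (pdefect p pmap rV x) (c x).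
Hypothesis cW : forall x, scalar_on AW BW (pdefect p pmap rW x) (c x).

(* By Schur's lemma the pairs [matched a b] form a skew field acting on both
  [V] and [W]; an intertwiner is a linear map over it. *)
Let matched (a : 'End(V)) (b : 'End(W)) : Prop :=
  [/\ forall x v, a (rV x v) = rV x (a v), forall x w, b (rW x w) = rW x (b w) &
      exists l, scalar_on AV BV a l /\ scalar_on AW BW b l].

Let matchedP k a b a' b' : matched a b -> matched a' b' ->
  matched (k *: a + a') (k *: b + b').
Proof.
move=> [aC bC [l [al bl]]] [a'C b'C [l' [al' bl']]]; split.
- by move=> x v; rewrite !add_lfunE !scale_lfunE aC a'C linearP.
- by move=> x v; rewrite !add_lfunE !scale_lfunE bC b'C linearP.
by exists (iota k * l + l'); split; exact: scalar_onP.
Qed.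

Let matched_comp a b a' b' : matched a b -> matched a' b' ->
  matched (a \o a')%VF (b \o b')%VF.
Proof.
move=> [aC bC [l [al bl]]] [a'C b'C [l' [al' bl']]]; split.
- by move=> x v; rewrite !comp_lfunE a'C aC.
- by move=> x v; rewrite !comp_lfunE b'C bC.
by exists (l * l'); split; apply: scalar_on_comp.
Qed.

Let matched1 : matched \1%VF \1%VF.
Proof.
split; [by move=> *; rewrite !id_lfunE | by move=> *; rewrite !id_lfunE |].
by exists 1; split; exact: scalar_on1.
Qed.

Let matched_pdefect x : matched (pdefect p pmap rV x) (pdefect p pmap rW x).
Proof.
split; [exact: pdefect_comm | exact: pdefect_comm |].
by exists (c x).
Qed.

(** The scalar shared with 0 is 0, so [b] has a nonzero kernel, and Schur's lemma makes it zero. *)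
Let matched_eq0 b : matched 0 b -> b = 0.
Proof.
move=> [_ bC [l [/(scalar_on0 BAV) -> bl]]]; apply/eqP; apply: contraT => b0.
by have := scalar_on_inj ABW BAW bl; rewrite (schur_inj W_irr bC b0).
Qed.

Let matched_inj a b : matched a b -> a != 0 -> lker a == 0%VS.
Proof. by move=> [aC _ _] a0; have := schur_inj V_irr aC a0. Qed.

(** Let [U] be maximal among the stable subspaces avoiding v0. Every vector is of the form a v0 + u,
    and a v0 + u |-> b w0 is well defined and compatible with matched pairs, in particular with
    those of x^p - x^[p]. *)
Lemma common_character_hom : exists f : 'Hom(V, W), f != 0 /\
  forall x v, f (pdefect p pmap rV x v) = pdefect p pmap rW x (f v).
Proof.
have [v0 v00] := irreducible_nz V_irr; have [w0 w00] := irreducible_nz W_irr.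
have matched0 : matched 0 0.
  by have := matchedP (-1) matched1 matched1; rewrite !scaleN1r !addNr.
pose stable (U : {vspace V}) := forall a b u, matched a b -> u \in U -> a u \in U.
have [|U [v0U sU] maxU] := @ex_max_vspace _ V (fun U => v0 \notin U /\ stable U).
  exists 0%VS; split; first by rewrite memv0.
  by move=> a b u _; rewrite !memv0 => /eqP->; rewrite linear0.
have orbit t : exists G : {vspace V}, stable G /\
    forall g, g \in G <-> exists a b u, [/\ matched a b, u \in U & g = a t + u].
  have [||G GP] := @vspace_of_pred _ V
    (fun g => exists a b u, [/\ matched a b, u \in U & g = a t + u]).
  - by exists 0, 0, 0; rewrite mem0v zero_lfunE addr0.
  - move=> k _ _ [a [b [u [ab uU ->]]]] [a' [b' [u' [ab' uU' ->]]]].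
    exists (k *: a + a'), (k *: b + b'), (k *: u + u').
    split; [exact: matchedP | by rewrite memvD ?memvZ |].
    by rewrite add_lfunE scale_lfunE scalerDr addrACA.
  exists G; split=> // a b g ab /GP[a' [b' [u [ab' uU ->]]]]; apply/GP.
  exists (a \o a')%VF, (b \o b')%VF, (a u); split; first exact: matched_comp.
    exact: sU ab uU.
  by rewrite comp_lfunE linearD.
have [G [sG GP]] := orbit v0.
(* For t outside [G], maximality of [U] gives v0 = a t + u; then a t lies in [G], and injectivity of
   a puts t there. *)
have Gall t : t \in G.
  apply: contraT => tG; have [G' [sG' GP']] := orbit t.
  have tG' : t \in G'.
    by apply/GP'; exists \1%VF, \1%VF, 0; rewrite mem0v id_lfunE addr0.
  have UG' : (U <= G')%VS.
    apply/subvP => u uU; apply/GP'; exists 0, 0, u.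
    by rewrite zero_lfunE add0r.
  have [v0G'|v0G'] := boolP (v0 \in G'); last first.
    have eG' := maxU G' (conj v0G' sG') UG'.
    case/negP: tG; apply/GP; exists 0, 0, t.
    by rewrite zero_lfunE add0r -eG'.
  move/GP': v0G' => [a [b [u [ab uU e]]]].
  have [a0|a0] := eqVneq a 0.
    by move: v0U; rewrite e a0 zero_lfunE add0r uU.
  case/negP: tG; apply: (inj_stable_mem (matched_inj ab a0)) => [g|].
    exact: sG ab.
  apply/GP; exists \1%VF, \1%VF, (- u); split; rewrite ?memvN // id_lfunE.
  by rewrite {1}e addrK.
(* The difference of the two pairs has a first component sending v0 into [U]. Were it nonzero, it
   would be injective and v0 would lie in [U]. *)
have uniq a b a' b' u u' : matched a b -> matched a' b' -> u \in U -> u' \in U ->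
    a v0 + u = a' v0 + u' -> b = b'.
  move=> ab ab' uU uU' e.
  have dab := matchedP (-1) ab' ab.
  have [a0|a0] := eqVneq (-1 *: a' + a) 0.
    move: dab; rewrite a0 => /matched_eq0/eqP.
    by rewrite scaleN1r addrC subr_eq0 => /eqP.
  case/negP: v0U; apply: (inj_stable_mem (matched_inj dab a0)) => [g|].
    exact: sU dab.
  rewrite add_lfunE scale_lfunE scaleN1r.
  have -> : - a' v0 + a v0 = u' - u.
    by apply/eqP; rewrite addrC subr_eq addrAC eq_sym subr_eq e addrC eqxx.
  by rewrite memvB.
pose graph t r := exists a b u, [/\ matched a b, u \in U, t = a v0 + u & r = b w0].
have [f fP] : exists f : V -> W, forall t, graph t (f t).
  suff /boolp.choice[f fP] : forall t, exists r, graph t r by exists f.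
  move=> t; have /GP[a [b [u [ab uU ->]]]] := Gall t.
  by exists (b w0), a, b, u.
have fE a b u : matched a b -> u \in U -> f (a v0 + u) = b w0.
  move=> ab uU; have [a' [b' [u' [ab' uU' e ->]]]] := fP (a v0 + u).
  by rewrite (uniq _ _ _ _ _ _ ab ab' uU uU' e).
have fl : linear f.
  move=> k s t; have [a [b [u [ab uU -> ->]]]] := fP s.
  have [a' [b' [u' [ab' uU' -> ->]]]] := fP t.
  have -> : k *: (a v0 + u) + (a' v0 + u') = (k *: a + a') v0 + (k *: u + u').
    by rewrite add_lfunE scale_lfunE scalerDr addrACA.
  by rewrite (fE _ _ _ (matchedP k ab ab')) ?memvD ?memvZ // add_lfunE scale_lfunE.
have [g gE] := linear_Hom fl; exists g; split.
  apply: contraNneq w00 => g0; have := fE _ _ _ matched1 (mem0v U).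
  by rewrite -gE g0 zero_lfunE id_lfunE => <-.
move=> x v; rewrite !gE; have [a [b [u [ab uU -> ->]]]] := fP v.
have -> : pdefect p pmap rV x (a v0 + u) =
    (pdefect p pmap rV x \o a)%VF v0 + pdefect p pmap rV x u.
  by rewrite linearD comp_lfunE.
rewrite (fE _ _ _ (matched_comp (matched_pdefect x) ab)) ?comp_lfunE //.
exact: sU (matched_pdefect x) uU.
Qed.

End Intertwiner.
End CommonCharacter.

(** * Jacobson's formula *)

Section JacobsonFormula.
Variables (R : nzRingType) (p : nat).
Hypothesis charR : p \in [pchar R].

(** Binomial expansion of left minus right multiplication by [T], which commute. *)
Lemma iter_ad (T a : R) n :
  iter n (fun q => T * q - q * T) a =
  \sum_(k < n.+1) ((-1) ^+ (n - k) * T ^+ k * a * T ^+ (n - k)) *+ 'C(n, k).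
Proof.
elim: n => [|n IHn]; first by rewrite big_ord1 /= mulr1 !mul1r.
rewrite iterS IHn mulr_sumr mulr_suml.
under [X in X - _]eq_bigr => i _.
  rewrite mulrnAr !mulrA (commrX _ (commrN1 T)) -[_ * T * _]mulrA -exprS.
  over.
under [X in _ - X]eq_bigr => i _.
  rewrite mulrnAl -!mulrA -exprSr -subSn; last by rewrite -ltnS.
  over.
rewrite [RHS]big_ord_recl /= bin0 /bump /=.
under [X in _ = _ + X]eq_bigr do rewrite add1n binS mulrnDr subSS.
rewrite big_split /= addrA addrC; congr (_ + _).
rewrite -sumrN big_ord_recl /= bin0 !subn0; congr (_ + _).
  by rewrite (exprS (-1)) mulN1r !mulNr -!mulrA.
rewrite [RHS]big_ord_recr /= bin_small // mulr0n addr0.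
apply: eq_bigr => i _; rewrite /bump /= add1n subSS -mulNrn; congr (_ *+ _).
have -> : (-1) ^+ (n - i) = - (-1) ^+ (n - i.+1) :> R.
  by rewrite -(subnSK (ltn_ord i)) exprS mulN1r.
by rewrite !mulNr -!mulrA.
Qed.

Lemma bin_pred_pchar (u : R) k : (k < p)%N -> u *+ 'C(p.-1, k) = (-1) ^+ k * u.
Proof.
have p_pr := pcharf_prime charR.
elim: k => [|k IHk] kp; first by rewrite bin0 mul1r.
have : u *+ 'C(p, k.+1) = 0.
  have /dvdnP[m ->] := prime_dvd_bin p_pr (kp : (0 < k.+1 < p)%N).
  by rewrite -mulr_natr natrM (pcharf0 charR) !mulr0.
rewrite -{1}(prednK (prime_gt0 p_pr)) binS mulrnDr IHk ?(ltnW kp) // => /eqP.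
by rewrite addr_eq0 exprS mulN1r mulNr => /eqP.
Qed.

Lemma iter_ad_pchar (T a : R) :
  iter p.-1 (fun q => T * q - q * T) a = \sum_(k < p) T ^+ k * a * T ^+ (p.-1 - k).
Proof.
have p_pr := pcharf_prime charR; have p1 := prednK (prime_gt0 p_pr).
rewrite iter_ad p1; apply: eq_bigr => k _; rewrite bin_pred_pchar // -!mulrA mulrA.
rewrite -exprD subnKC; last by rewrite -ltnS p1.
(* The signs combine to (-1)^(p-1), which is 1 for p = 2 too: it is the binomial coefficient of p-1
   over p-1. *)
have := @bin_pred_pchar 1 p.-1; rewrite p1 binn mulr1 => <- //.
by rewrite mul1r.
Qed.

End JacobsonFormula.

Section JacobsonPoly.
Variables (R : nzRingType) (p : nat).
Hypothesis charR : p \in [pchar R].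
Variables (A B : R).

(** Associative counterpart of [ad_coef]: the coefficient of t^j in ad(t A + B)^n (A). *)
Fixpoint ad_pcoef (n j : nat) : R :=
  match n with
  | 0 => if j == 0%N then A else 0
  | n'.+1 => (B * ad_pcoef n' j - ad_pcoef n' j * B) +
     (if j is j'.+1 then A * ad_pcoef n' j' - ad_pcoef n' j' * A else 0)
  end.

Let T : {poly R} := A *: 'X + B%:P.

Let T_mul (q : {poly R}) j : (T * q)`_j = B * q`_j + (if j is j'.+1 then A * q`_j' else 0).
Proof.
rewrite mulrDl coefD coefCM addrC; congr (_ + _).
by rewrite -scalerAl coefZ coefXM; case: j => [|j] //=; rewrite mulr0.
Qed.

Let mul_T (q : {poly R}) j : (q * T)`_j = q`_j * B + (if j is j'.+1 then q`_j' * A else 0).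
Proof.
rewrite mulrDr coefD coefMC addrC; congr (_ + _).
by rewrite -mul_polyC mulrA coefMX coefMC; case: j.
Qed.

Let size_T n : (size (T ^+ n) <= n.+1)%N.
Proof.
apply: leq_trans (size_poly_exp_leq _ _) _; rewrite ltnS -{2}[n]mul1n leq_mul2r.
have sT : (size T <= 2)%N.
  apply: leq_trans (size_polyD _ _) _; rewrite geq_max.
  rewrite (leq_trans (size_scale_leq _ _)) ?size_polyX //=.
  by rewrite (leq_trans (size_polyC_leq1 _)).
by rewrite -(subn1 (size T)) leq_subLR sT orbT.
Qed.

Lemma coef_T_lead n : (T ^+ n)`_n = A ^+ n.
Proof.
elim: n => [|n IHn]; first by rewrite !expr0 coef1.
by rewrite !exprS T_mul IHn nth_default ?mulr0 ?add0r ?size_T.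
Qed.

Lemma coef_T0 n : (T ^+ n)`_0 = B ^+ n.
Proof.
elim: n => [|n IHn]; first by rewrite !expr0 coef1.
by rewrite !exprS T_mul IHn addr0.
Qed.

(** Evaluation of (t A + B)^n at t = 1. *)
Lemma horner_T n : (A + B) ^+ n = \sum_(i < n.+1) (T ^+ n)`_i.
Proof.
elim: n => [|n IHn]; first by rewrite big_ord1 expr0 coef1.
rewrite !exprS IHn mulrDl addrC.
under [RHS]eq_bigr do rewrite T_mul.
rewrite big_split /= !mulr_sumr; congr (_ + _).
  by rewrite [RHS]big_ord_recr /= [X in _ + B * X]nth_default ?mulr0 ?addr0 ?size_T.
by rewrite [RHS]big_ord_recl /= add0r.
Qed.

Lemma deriv_T_exp n : (T ^+ n)^`() = \sum_(k < n) T ^+ k * A%:P * T ^+ (n.-1 - k).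
Proof.
have dT : T^`() = A%:P by rewrite derivD derivZ derivX derivC addr0 alg_polyC.
elim: n => [|n IHn]; first by rewrite big_ord0 expr0 derivC.
rewrite exprS derivM dT IHn big_ord_recl /= subn0 mul1r mulr_sumr; congr (_ + _).
apply: eq_bigr => i _; rewrite /bump /= add1n exprS !mulrA.
by congr (_ * T ^+ _); case: n i {IHn} => [|n] [i] //= _; rewrite subSS.
Qed.

Lemma coef_iter_ad n j : (iter n (fun q => T * q - q * T) A%:P)`_j = ad_pcoef n j.
Proof.
elim: n j => [|n IHn] j /=; first by rewrite coefC.
rewrite coefB T_mul mul_T IHn; case: j => [|j]; first by rewrite !addr0.
by rewrite IHn; zmodule.
Qed.

(* Compare the coefficients of [t^(i-1)] in the derivative of [(t A + B)^p]. *)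
Lemma jacobson_formula : exists s : nat -> R,
  (A + B) ^+ p = A ^+ p + B ^+ p + \sum_(1 <= i < p) s i /\
  forall i, (0 < i < p)%N -> s i *+ i = ad_pcoef p.-1 i.-1.
Proof.
have p_pr := pcharf_prime charR.
exists (fun i => (T ^+ p)`_i); split.
  rewrite horner_T big_ord_recr /= coef_T_lead.
  rewrite -(big_mkord xpredT (fun i => (T ^+ p)`_i)) big_ltn ?prime_gt0 //.
  by rewrite coef_T0; zmodule.
case=> // i ip; rewrite -coef_deriv deriv_T_exp -iter_ad_pchar ?coef_iter_ad //.
exact: (rmorph_pchar (polyC : {rmorphism R -> {poly R}}) charR).
Qed.

End JacobsonPoly.

(** * Existence of characters *)

Section PDefectLinear.
Variables (F : fieldType) (p : nat) (L : lieType F) (pmap : L -> L).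
Hypothesis charF : p \in [pchar F].
Hypothesis pmapP : restricted p pmap.
Variables (V : vectType F) (rho : lieRep L V).

Lemma pdefectZ a x : pdefect p pmap rho (a *: x) = a ^+ p *: pdefect p pmap rho x.
Proof.
case: pmapP => _ pmapZ _; apply/lfunP => v; rewrite scale_lfunE !pdefectE pmapZ.
rewrite [rho (_ ^+ _ *: _)]linearZ scale_lfunE scalerBr; congr (_ - _).
elim: p => [|n IHn] /=; first by rewrite scale1r.
by rewrite IHn linearZ /= [rho (a *: x)]linearZ scale_lfunE scalerA -exprSr.
Qed.

(** Jacobson's formula in End(V) has as mixed terms the images of those of (x + y)^[p], so they
    cancel. *)
Lemma pdefectD x y : pdefect p pmap rho (x + y) = pdefect p pmap rho x + pdefect p pmap rho y.
Proof.
case: pmapP => _ _ pmapD; apply/lfunP => v; rewrite add_lfunE !pdefectE pmapD.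
(* A nonzero vector is required to make End(V) a nonzero ring. *)
have [->|v0] := eqVneq v 0.
  have i0 z : iter p (rho z) 0 = 0 by elim: p => //= n ->; rewrite linear0.
  by rewrite !i0 !linear0 !addr0.
have dV : (0 < dim V)%N.
  by rewrite lt0n -dimvf dimv_eq0; apply: contraNneq v0 => e; rewrite -memv0 -e memvf.
pose R := lfun_comp_nzRingType dV.
pose r z : R := rho z.
have mulE (f g : R) w : (f * g : R) w = f (g w) by exact: comp_lfunE.
have expE (f : R) n w : (f ^+ n : R) w = iter n f w.
  by elim: n => [|n IHn]; [exact: id_lfunE | rewrite exprS mulE IHn].
have charR : p \in [pchar R].
  apply/andP; split; first exact: pcharf_prime charF.
  apply/eqP; rewrite -[LHS]/((\1%VF : 'End(V)) *+ p).
  by rewrite -scaler_nat (pcharf0 charF) scale0r.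
have adE n i : ad_pcoef (r x) (r y) n i = r (ad_coef x y n i).
  have br z t : r z * r t - r t * r z = r (lie z t).
    apply/lfunP => w; rewrite lrepP -[LHS]/((_ - _ : 'End(V)) w).
    by rewrite add_lfunE opp_lfunE !mulE.
  elim: n i => [|n IHn] [|i] //=; rewrite ?IHn ?br ?addr0 // /r.
- by rewrite linear0.
- by rewrite linearD.
have [s [sE sP]] := jacobson_formula charR (r x) (r y).
(* As i is invertible in [F], the value of i s_i determines s_i. *)
have sJ i : (0 < i < p)%N -> s i = r (jacobson_s p i x y).
  move=> ip; have i0 : (i%:R : F) != 0.
    rewrite -(dvdn_pcharf charF) gtnNdvd //; by case/andP: ip.
  rewrite /jacobson_s /r linearZ /= -/(r _) -adE -sP // -[s i *+ i]/((s i : 'End(V)) *+ i).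
  by rewrite -scaler_nat scalerA mulVf ?scale1r.
have e : iter p (rho (x + y)) v = iter p (rho x) v + iter p (rho y) v
    + rho (\sum_(1 <= i < p) jacobson_s p i x y) v.
  rewrite linearD -[LHS](expE (r x + r y)) sE.
  rewrite -[LHS]/((_ + _ : 'End(V)) v) add_lfunE.
  rewrite -[X in X + _]/((_ + _ : 'End(V)) v) add_lfunE !expE; congr (_ + _).
  rewrite linear_sum /= [in LHS]big_nat [in RHS]big_nat.
  congr (fun_of_lfun _ v); apply: eq_bigr => i ip.
  by rewrite sJ.
by rewrite e !linearD !add_lfunE; zmodule.
Qed.

End PDefectLinear.

(** * Composition series and scalar endomorphisms *)

Section CompositionSeries.
Variables (F : fieldType) (L : lieType F) (V : vectType F) (rho : lieRep L V).

(** A submodule of the factor pulls back to a submodule [X] between [A] and [B]. *)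
Lemma irreducible_facrep_min (A B : submod rho) : (A <= B)%VS -> ~~ (B <= A)%VS ->
  (forall U : submod rho, (A <= U)%VS -> (U <= B)%VS ->
     U = A :> {vspace V} \/ U = B :> {vspace V}) ->
  irreducible (facrep B A).
Proof.
move=> AB /subvPn[v vB vA] minB; split.
  move=> e; have : facpi B A v \in (fullv : {vspace facv B A}) by exact: memvf.
  by rewrite e memv0 facpi_kerP // (negbTE vA).
have vB' (u : facv B A) : vsval u \in B by rewrite -[u]facpiK facpi_inB.
move=> U; pose X := (B :&: facpi B A @^-1: U)%VS.
have XP w : (w \in X) = (w \in B) && (facpi B A w \in U).
  by rewrite memv_cap memv_preim.
have sX x w : w \in X -> rho x w \in X.
  rewrite !XP => /andP[wB wU]; rewrite submodP //=.
  by rewrite -facrep_facpi // submodP.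
case: (minB (Submod sX)) => /= [|| e | e].
- apply/subvP => a aA; rewrite XP (subvP AB) //=.
  have /eqP -> : facpi B A a == 0 by rewrite facpi_kerP ?(subvP AB).
  exact: mem0v.
- exact: capvSl.
- have XA w : w \in X -> w \in A by rewrite -e.
  left; apply/eqP; rewrite -subv0; apply/subvP => u uU; rewrite memv0.
  by rewrite -[u]facpiK facpi_kerP // XA // XP vB' facpiK.
have BX w : w \in B -> w \in X by rewrite -e.
right; apply/eqP; rewrite eqEsubv subvf; apply/subvP => u _.
by have := BX _ (vB' u); rewrite XP facpiK => /andP[].
Qed.

(** Induction on the codimension of [A]; the next term is a minimal stable subspace properly above
    it. *)
Lemma composition_series_from (A : submod rho) : exists n (U : nat -> submod rho),
  [/\ U 0%N = A, U n = fullv :> {vspace V} &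
      forall i, (i < n)%N ->
        (U i <= U i.+1)%VS /\ irreducible (facrep (U i.+1) (U i))].
Proof.
have [d] := ubnP (\dim {:V} - \dim A); elim: d A => // d IHd A dA.
have [eA|/eqP neA] := eqVneq (A : {vspace V}) fullv; first by exists 0%N, (fun=> A).
pose P (B : {vspace V}) := [/\ (A <= B)%VS, ~~ (B <= A)%VS &
  forall x v, v \in B -> rho x v \in B].
have [|B [AB BA sB] minB] := @ex_min_vspace _ V P.
  exists fullv; split; [exact: subvf | | by move=> *; exact: memvf].
  by apply/negP => fA; apply: neA; apply/eqP; rewrite eqEsubv subvf.
have irrB : irreducible (facrep (Submod sB) A).
  apply: irreducible_facrep_min => // U AU UB.
  have [UA|UA] := boolP (U <= A)%VS.
    by left; apply/eqP; rewrite eqEsubv UA AU.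
  by right; apply: minB => //; split=> // x v; exact: submodP.
have [|n [U [U0 Un Ui]]] := IHd (Submod sB).
  rewrite -ltnS; apply: leq_trans dA; rewrite ltnS ltn_sub2l //.
    rewrite ltn_neqAle dimvS ?subvf // andbT; apply/eqP => e; apply: neA.
    by apply/eqP; rewrite eqEdim subvf e leqnn.
  rewrite ltn_neqAle dimvS // andbT; apply: contra BA => /eqP e.
  by have /eqP -> : A == B :> {vspace V} by rewrite eqEdim AB e leqnn.
exists n.+1, (fun i => if i is i'.+1 then U i' else A); split=> // -[|i] //=.
  by rewrite U0.
exact: Ui.
Qed.

Lemma composition_series_exists (v : V) : v != 0 ->
  exists n (U : nat -> submod rho), (0 < n)%N /\ composition_series n U.
Proof.
move=> v0; have s0 x w : w \in (0%VS : {vspace V}) -> rho x w \in (0%VS : {vspace V}).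
  by rewrite !memv0 => /eqP->; rewrite linear0.
have [n [U [U0 Un Ui]]] := composition_series_from (Submod s0).
exists n, U; split; last by split=> //; rewrite U0.
case: n Un {Ui} => // ; rewrite U0 /= => e.
by move: v0; rewrite -memv0 e memvf.
Qed.

End CompositionSeries.

Lemma closed_eigenvector (E : closedFieldType) (M : vectType E) (a : 'End(M)) (m : M) :
  m != 0 -> exists l (v : M), v != 0 /\ a v = l *: v.
Proof.
move=> m0; pose e := vbasis {:M}; have eb : basis_of {:M} e := vbasisP _.
pose A := passmx.mxof e e a.
have nz : (0 < \dim {:M})%N.
  by rewrite lt0n dimv_eq0; apply: contraNneq m0 => ez; rewrite -memv0 -ez memvf.
have : size (char_poly A) != 1%N by rewrite size_char_poly eqSS -lt0n.
move=> /closed_rootP[l]; rewrite -eigenvalue_root_char => /eigenvalueP[v vA v0].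
exists l, (passmx.vecof e v); split; first by rewrite (passmx.vecof_eq0 eb).
by rewrite (@passmx.hom_vecof _ _ _ e e) // vA /passmx.vecof scaler_sumr; apply: eq_bigr => i _; rewrite mxE scalerA.
Qed.

Lemma schur_scalar (E : closedFieldType) (L : lieType E) (M : vectType E)
    (rho : lieRep L M) (a : 'End(M)) : irreducible rho ->
  (forall x v, a (rho x v) = rho x (a v)) -> exists l, forall v, a v = l *: v.
Proof.
move=> irr aC; have [m m0] := irreducible_nz irr.
have [l [v [v0 av]]] := closed_eigenvector a m0; exists l.
pose b : 'End(M) := a - l *: \1%VF.
have bE u : b u = a u - l *: u by rewrite add_lfunE opp_lfunE scale_lfunE id_lfunE.
have [b0|b0] := eqVneq b 0.
  by move=> u; apply/eqP; rewrite -subr_eq0 -bE b0 zero_lfunE.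
have bC x u : b (rho x u) = rho x (b u).
  by rewrite !bE aC linearB /= [rho x (l *: u)]linearZ.
have /lker0P binj := schur_inj irr bC b0.
by case/eqP: v0; apply: binj; rewrite bE av subrr linear0.
Qed.

Section ClusterNonempty.
Variables (F : fieldType) (E : closedFieldType) (iota : {rmorphism F -> E}) (p : nat).
Variables (L : lieType F) (pmap : L -> L).
Hypothesis charF : p \in [pchar F].
Hypothesis pmapP : restricted p pmap.
Variables (V : vectType F) (rho : lieRep L V).

Lemma bc_inj_eq0 (v : V) : bc iota v = 0 -> v = 0.
Proof.
move=> v0; rewrite [v]bc_basisE big1 // => i _.
have /eqP := congr1 (fun u : 'rV_ _ => u 0 i) v0; rewrite !mxE fmorph_eq0 => /eqP->.
exact: scale0r.
Qed.

Lemma bc_end_comm (a : 'End(V)) y u : (forall x v, a (rho x v) = rho x (a v)) ->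
  bc_end iota a (bc_rep iota rho y u) = bc_rep iota rho y (bc_end iota a u).
Proof.
move=> aC; elim/bc_ind: y => [|k y z IHy IHz|y].
- by rewrite (linear0 (bc_rep iota rho)) !zero_lfunE linear0.
- rewrite (linearP (bc_rep iota rho)) !add_lfunE !scale_lfunE.
  by rewrite [LHS](linearP (bc_end iota a)); congr (_ *: _ + _).
rewrite -2!comp_lfunE; apply: bc_linear_eq u => v.
by rewrite !comp_lfunE !(bc_repE, bc_end_bc) aC.
Qed.

(** By Schur's lemma x^p - x^[p] acts on the factor as a scalar l(x), additive and p-semilinear in
    x; c(x) is its p-th root. *)
Lemma has_character_exists (B A : submod (bc_rep iota rho)) :
  irreducible (facrep B A) ->
  exists c, linear_for (iota \; *%R) c /\ has_character p pmap (facrep B A) c.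
Proof.
move=> irr; have pmap_ad x y : lie (pmap x) y = iter p (lie x) y by case: pmapP.
pose sg := facrep B A; pose D x := bc_end iota (pdefect p pmap rho x).
have vB (u : facv B A) : vsval u \in B by rewrite -[u]facpiK facpi_inB.
have DE x w : w \in B -> facpi B A (D x w) =
    iter p (sg (bc iota x)) (facpi B A w) - sg (bc iota (pmap x)) (facpi B A w).
  by move=> wB; rewrite /D bc_end_pdefect linearB /= iter_facrep // facrep_facpi.
have DB x w : w \in B -> D x w \in B.
  move=> wB; rewrite /D bc_end_pdefect; apply: memvB; last exact: submodP.
  by elim: p => // n IHn; rewrite iterS; exact: submodP.
have [l lP] : exists l : L -> E, forall x (u : facv B A),
    facpi B A (D x (vsval u)) = l x *: u.
  suff /boolp.choice[l lP] : forall x, exists l : E, forall u : facv B A,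
      facpi B A (D x (vsval u)) = l *: u by exists l.
  move=> x.
  have [Phi PhiE] : exists Phi : 'End(facv B A), forall u : facv B A,
      Phi u = facpi B A (D x (vsval u)).
    by apply: linear_Hom => k u v; rewrite !linearP.
  have PhiB w : w \in B -> Phi (facpi B A w) = facpi B A (D x w).
    by move=> wB; rewrite PhiE !DE ?facpiK.
  have PhiC y u : Phi (sg y u) = sg y (Phi u).
    rewrite PhiE /sg [facrep B A y u]facrepE -PhiE PhiB; last exact: submodP.
    rewrite /D bc_end_comm; last by move=> *; exact: (pdefect_comm charF pmap_ad).
    by rewrite PhiE facrep_facpi // DB.
  have [l lP] := schur_scalar irr PhiC.
  by exists l => u; rewrite -PhiE lP.
have [u u0] := irreducible_nz irr.
have lP' k x y : l (k *: x + y) = iota k ^+ p * l x + l y.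
  have : (l (k *: x + y) - (iota k ^+ p * l x + l y)) *: u = 0.
    rewrite scalerBl scalerDl -scalerA -!lP -linearP -linearB /D.
    rewrite pdefectD // pdefectZ // bc_endP rmorphXn subrr; exact: linear0.
  by move=> /eqP; rewrite scaler_eq0 (negbTE u0) orbF subr_eq0 => /eqP.
have p_gt0 := prime_gt0 (pcharf_prime charF).
have [c cP] : exists c : L -> E, forall x, c x ^+ p = l x.
  suff /boolp.choice[c cP] : forall x, exists c : E, c ^+ p = l x by exists c.
  move=> x; have : size ('X^p - (l x)%:P) != 1%N by rewrite size_XnsubC // eqSS -lt0n.
  move=> /closed_rootP[c]; rewrite /root !hornerE subr_eq0 => /eqP cE.
  by exists c.
have charE : p \in [pchar E] := rmorph_pchar iota charF.
exists c; split=> [k x y|x u'].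
  (* Linearity of c is checked after applying Frobenius, which is injective. *)
  apply: (fmorph_inj (pFrobenius_aut charE)).
  by rewrite /= rmorphD rmorphM /= !pFrobenius_autE !cP lP'.
by rewrite cP -lP DE // facpiK.
Qed.

Lemma cluster_nonempty : (exists v : V, v != 0) ->
  exists c, cluster iota p pmap rho c.
Proof.
move=> [v v0]; have bv0 : bc iota v != 0 by apply: contra_neq v0; exact: bc_inj_eq0.
have [n [U [n0 compU]]] := composition_series_exists (bc_rep iota rho) bv0.
case: (compU) => _ _ /(_ _ n0)[_ /has_character_exists[c [cl hc]]].
by exists c; split=> //; exists n, U; split=> //; exists 0%N.
Qed.

End ClusterNonempty.

(** * Generic admissible modules *)

Section Coefficients.
Variables (F : fieldType) (p : nat).
Hypothesis charF : p \in [pchar F].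
Variables (FF : lieType F -> Prop) (FF_form : formation FF) (FF_sat : saturated FF).
Variables (S : lieType F) (S_FF : FF S) (L : lieType F) (pmap : L -> L) (j : 'Hom(S, L)).
Hypothesis L_env : p_envelope p pmap j.

Let jM : lie_morphism j. Proof. by case: L_env. Qed.

Local Notation adm := (admissible FF L_env).

Definition coefficient (f : seq L -> F) : Prop :=
  exists (M : vectType F) (rho : lieRep L M) (m : M) (xi : 'Hom(M, F^o)),
    adm rho /\ forall w, f w = xi (wact rho w m).

Lemma wact_sumrep (M N : vectType F) (rho : lieRep L M) (sigma : lieRep L N) w m n :
  wact (sumrep rho sigma) w (m, n) = (wact rho w m, wact sigma w n).
Proof. by elim: w m n => //= x w IHw m n; rewrite !wact_cons sumrepE IHw. Qed.

Lemma coefficient_lin a f g : coefficient f -> coefficient g ->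
  coefficient (fun w => a * f w + g w).
Proof.
move=> [M [rho [m [xi [ar fE]]]]] [N [sigma [n [eta [as' gE]]]]].
exists (M * N)%type, (sumrep rho sigma), (m, n).
have [z zE] : exists z : 'Hom((M * N)%type, F^o), forall u : (M * N)%type, z u = a *: xi u.1 + eta u.2.
  apply: linear_Hom => k u v /=.
  by rewrite (linearP xi) (linearP eta) /= !scalerDr !scalerA (mulrC a) addrACA.
exists z; split=> [|w]; first exact: admissible_sum.
by rewrite zE wact_sumrep fE gE.
Qed.

(** A letter acting on a pure tensor acts on one factor or the other, which is the shuffle
    recursion. *)
Lemma coefficient_shuffle f g : coefficient f -> coefficient g ->
  coefficient (shuffle f g).
Proof.
move=> [M [rho [m [xi [ar fE]]]]] [N [sigma [n [eta [as' gE]]]]].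
exists _, (tensrep rho sigma), (tens m n).
have [z zE] : exists z : 'Hom('Hom('Hom(M, F^o), N), F^o), forall h, z h = eta (h xi).
  by apply: linear_Hom => k u v; rewrite add_lfunE scale_lfunE linearP.
exists z; split=> [|w]; first exact: admissible_tens.
rewrite zE (eq_shuffle w fE gE) {f g fE gE}; elim: w m n => [|x w IHw] m n.
  by rewrite /wact /= tensE linearZ.
rewrite wact_cons tensrepE -[tens (rho x m) n]scale1r wact_linear scale1r.
by rewrite add_lfunE linearD /= -!IHw.
Qed.

Lemma coefficient_unit (M : vectType F) (m : M) : m != 0 -> adm (trivrep L M) ->
  coefficient (@word_unit F L).
Proof.
move=> m0 aM; pose e := vbasis {:M}.
have [i ci] : exists i : 'I_(\dim {:M}), coord e i m != 0.
  apply/existsP; apply: contraT; rewrite negb_exists => /forallP h.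
  case/eqP: m0; rewrite (coord_vbasis (memvf m)) big1 // => i _.
  by have := h i; rewrite negbK => /eqP ->; rewrite scale0r.
have [z zE] : exists z : 'Hom(M, F^o), forall u, z u = (coord e i m)^-1 *: (coord e i u : F^o).
  by apply: linear_Hom => k u v; rewrite linearP scalerDr !scalerA mulrC.
exists M, (trivrep L M), m, z; split=> // -[|x w].
  by rewrite zE /word_unit /= [RHS]mulVf.
rewrite wact_cons trivrepE.
have -> : wact (trivrep L M) w 0 = 0 by elim: w => //= y w; rewrite wact_cons trivrepE.
by rewrite linear0.
Qed.

(** Direct sums of modules and vectors realise finitely many coefficients at a single vector. *)
Lemma coefficient_common (I : eqType) (f : I -> seq L -> F) (s : seq I) :
  (exists g, coefficient g) -> (forall i, coefficient (f i)) ->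
  exists (M : vectType F) (rho : lieRep L M) (m : M), adm rho /\
    forall i, i \in s -> exists xi : 'Hom(M, F^o), forall w, f i w = xi (wact rho w m).
Proof.
move=> [g [M0 [rho0 [m0 [_ [a0 _]]]]]] cf; elim: s => [|i s [M [rho [m [aM IHs]]]]].
  by exists M0, rho0, m0.
have [N [sigma [n [eta [aN fE]]]]] := cf i.
exists (N * M)%type, (sumrep sigma rho), (n, m); split; first exact: admissible_sum.
move=> k; rewrite inE => /orP[/eqP->|/IHs[xi xiE]].
  have [z zE] : exists z : 'Hom((N * M)%type, F^o), forall u : (N * M)%type, z u = eta u.1.
    by apply: linear_Hom => a u v; rewrite linearP.
  by exists z => w; rewrite zE wact_sumrep fE.
have [z zE] : exists z : 'Hom((N * M)%type, F^o), forall u : (N * M)%type, z u = xi u.2.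
  by apply: linear_Hom => a u v; rewrite linearP.
by exists z => w; rewrite zE wact_sumrep xiE.
Qed.

Definition orbit_map (M : vectType F) (rho : lieRep L M) (m : M) : 'Hom(L, M) :=
  linfun (fun x => rho x m).

Lemma orbit_mapE (M : vectType F) (rho : lieRep L M) (m : M) x :
  orbit_map rho m x = rho x m.
Proof. by apply: linfunE_of => a y z; rewrite lrepPl. Qed.

Record pointed_module := PointedModule {
  pm_sort : vectType F; pm_rep : lieRep L pm_sort; pm_point : pm_sort }.

(* A pair [(M, m)] with the smallest annihilator of [m]: taking direct sums,
  this annihilator kills all admissible modules. *)
Lemma admissible_generic (M0 : vectType F) (rho0 : lieRep L M0) : adm rho0 ->
  exists (M : vectType F) (rho : lieRep L M) (m : M), adm rho /\
    forall x, rho x m = 0 ->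
    forall (N : vectType F) (sigma : lieRep L N), adm sigma -> sigma x = 0.
Proof.
move=> a0; pose ann t := lker (orbit_map (pm_rep t) (pm_point t)).
have annP t x : (x \in ann t) = (pm_rep t x (pm_point t) == 0).
  by rewrite memv_ker orbit_mapE.
have [|[M rho m] aM minM] :=
    @ex_argmin pointed_module (fun t => \dim (ann t)) (fun t => adm (pm_rep t)).
  by exists (PointedModule rho0 0).
exists M, rho, m; split=> // x xm N sigma aN; apply/lfunP => n; rewrite zero_lfunE.
pose t := PointedModule rho m.
pose t' := @PointedModule (M * N)%type (sumrep rho sigma) (m, n).
have sub : (ann t' <= ann t)%VS.
  by apply/subvP => y; rewrite !annP /= sumrepE /= => /eqP[-> _].
have eann : ann t' = ann t.
  by apply/eqP; rewrite eqEdim sub; apply: (minM t'); exact: admissible_sum.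
have : x \in ann t' by rewrite eann annP /= xm.
by rewrite annP /= sumrepE /= => /eqP[_ ->].
Qed.

(* [x_1, ..., x_n] is a basis of [L] modulo the common kernel of the
  admissible modules; [Y_1, ..., Y_n] restrict to the dual basis. *)
Lemma dual_coefficients (M0 : vectType F) (m0 : M0) : m0 != 0 -> adm (trivrep L M0) ->
  exists n (xs : 'I_n -> L) (Y : 'I_n -> seq L -> F),
  [/\ forall i, coefficient (Y i), forall i, Y i [::] = 0,
      forall i k, Y i [:: xs k] = (i == k)%:R &
      forall x, exists c : 'I_n -> F, forall (N : vectType F) (sigma : lieRep L N),
        adm sigma -> sigma (x - \sum_i c i *: xs i) = 0].
Proof.
move=> m00 a0; have [M [rho [m [aM genM]]]] := admissible_generic a0.
pose sg := orbit_map rho m; have sgE := orbit_mapE rho m.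
pose e := vbasis (limg sg).
have [xi xiE] : exists xi : 'I_(\dim (limg sg)) -> 'Hom(M, F^o), forall i u, xi i u = coord e i u.
  suff /boolp.choice[xi xiE] : forall i, exists xi : 'Hom(M, F^o), forall u, xi u = coord e i u.
    by exists xi.
  by move=> i; apply: linear_Hom => a u v; rewrite linearP.
(* The [xs] lift a basis of L m; whatever annihilates m kills every admissible module. *)
pose xs i := (sg^-1)%VF e`_i.
have ei (i : 'I_(\dim (limg sg))) : e`_i \in limg sg.
  by apply: vbasis_mem; rewrite mem_nth ?size_tuple.
have xsE (i : 'I_(\dim (limg sg))) : rho (xs i) m = e`_i by rewrite -sgE limg_lfunVK.
exists (\dim (limg sg)), xs.
(* The unit term makes the coordinate vanish on the empty word and leaves nonempty words
   unaffected. *)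
exists (fun i (w : seq L) => - (xi i m : F) * @word_unit F L w + (xi i (wact rho w m) : F)); split=> [i|i|i k|x].
- apply: coefficient_lin; first exact: coefficient_unit m00 a0.
  by exists M, rho, m, (xi i).
- by rewrite /word_unit /wact /= mulr1 addNr.
- rewrite /word_unit /= mulr0 add0r wact_cons /wact /= xsE xiE.
  by rewrite coord_free ?(basis_free (vbasisP _)) // eq_sym.
exists (fun i => coord e i (sg x)) => N sigma aN; apply: genM aN.
rewrite -sgE linearB linear_sum /= {1}(coord_vbasis (memv_img sg (memvf x))).
rewrite -sumrB big1 // => i _.
have -> : sg (coord e i (sg x) *: xs i) = coord e i (sg x) *: e`_i.
  by rewrite linearZ /=; congr (_ *: _); rewrite -xsE; exact: sgE.
exact: subrr.
Qed.

End Coefficients.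

(** * Transfer of centrality *)

Section Transfer.
Variables (F : fieldType) (p : nat).
Hypothesis charF : p \in [pchar F].
Variables (FF : lieType F -> Prop) (FF_form : formation FF) (FF_sat : saturated FF).
Variables (S : lieType F) (S_FF : FF S) (L : lieType F) (pmap : L -> L) (j : 'Hom(S, L)).
Hypothesis L_env : p_envelope p pmap j.
Hypothesis L_center : forall z, center L z -> pmap z = 0.

Hypothesis jM : lie_morphism j.
Let pmap_ad x y : lie (pmap x) y = iter p (lie x) y.
Proof. by case: L_env => -[+ _ _] _ _ _; apply. Qed.

Local Notation adm := (admissible FF L_env).

Lemma iter_sumrep (M N : vectType F) (rho : lieRep L M) (sigma : lieRep L N) x n u :
  iter n (sumrep rho sigma x) u = (iter n (rho x) u.1, iter n (sigma x) u.2).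
Proof. by elim: n => [|n /= ->]; [case: u | rewrite sumrepE]. Qed.

Lemma admissible_kernel : exists R : {vspace L},
  [/\ forall (N : vectType F) (sigma : lieRep L N) x, adm sigma -> x \in R -> sigma x = 0,
      forall x, (forall (N : vectType F) (sigma : lieRep L N), adm sigma -> sigma x = 0) -> x \in R,
      forall y x, x \in R -> lie y x \in R &
      forall x, x \in R -> exists k, iter k pmap x = 0].
Proof.
have [||R RP] := @vspace_of_pred _ L
    (fun x => forall (N : vectType F) (sigma : lieRep L N), adm sigma -> sigma x = 0).
- by move=> N sigma _; exact: linear0.
- by move=> a u v uP vP N sigma aN; rewrite linearP /= (uP _ _ aN) (vP _ _ aN) scaler0 addr0.
exists R; split.
- by move=> N sigma x aN /RP; apply.
- by move=> x /RP.
- move=> y x /RP xP; apply/RP => N sigma aN; apply/lfunP => v.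
  by rewrite lrepP (xP _ _ aN) !zero_lfunE linear0 subrr.
by move=> x /RP xP; exact: (admissible_ker_nilpotent charF FF_form S_FF L_center xP).
Qed.

Section Modules.
Variables (V W : vectType F) (rV : lieRep L V) (rW : lieRep L W).

Let h := homrep rV rW.

(** On these maps x^p acts by f |-> x^p f - f x^p, from which the operators x^p - x^[p] cancel.
    Stability holds because they commute with [L]. *)
Lemma intertwiner_space : exists B : {vspace 'Hom(V, W)},
  [/\ forall f, f \in B <->
        (forall x v, f (pdefect p pmap rV x v) = pdefect p pmap rW x (f v)),
      forall x f, f \in B -> h x f \in B &
      forall x f, f \in B -> iter p (h x) f = h (pmap x) f].
Proof.
have [||B BP] := @vspace_of_pred _ _
    (fun f : 'Hom(V, W) => forall x v, f (pdefect p pmap rV x v) = pdefect p pmap rW x (f v)).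
- by move=> x v; rewrite !zero_lfunE linear0.
- by move=> a f g fP gP x v; rewrite !add_lfunE !scale_lfunE fP gP linearP.
exists B; split=> // [x f /BP fP|x f /BP fP].
  apply/BP => y v; rewrite !homrepE fP linearB /=.
  by rewrite !(pdefect_comm charF pmap_ad) -(pdefect_comm charF pmap_ad rV) fP.
apply/lfunP => v; rewrite iter_homrep // homrepE.
have := fP x v; rewrite !pdefectE linearB /= => /eqP.
rewrite subr_eq => /eqP ->.
by zmodule.
Qed.

(** On [B] the p^k-th power of x acts as its k-fold p-power, so [R] acts nilpotently and Engel's
    theorem applies. *)
Lemma restricted_invariant (B : {vspace 'Hom(V, W)}) (R : {vspace L}) f :
  (forall x f, f \in B -> h x f \in B) ->
  (forall x f, f \in B -> iter p (h x) f = h (pmap x) f) ->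
  (forall y x, x \in R -> lie y x \in R) ->
  (forall x, x \in R -> exists k, iter k pmap x = 0) ->
  f \in B -> f != 0 ->
  exists e, [/\ e \in B, e != 0 & forall x, x \in R -> h x e = 0].
Proof.
move=> sB rB idR nilR fB f0.
have iterB k x g : g \in B -> iter (p ^ k) (h x) g = h (iter k pmap x) g.
  elim: k x g => [|k IHk] x g gB //.
  rewrite expnS iterM [iter k.+1 pmap x]iterS -rB //.
  have sBk n g' : g' \in B -> iter n (h (iter k pmap x)) g' \in B.
    by move=> g'B; elim: n => // n IHn; rewrite iterS; exact: sB.
  suff e m : iter m (iter (p ^ k) (h x)) g = iter m (h (iter k pmap x)) g by [].
  by elim: m => // m IHm; rewrite !iterS IHm IHk //; exact: sBk.
have [||||||e [eB e0 Re]] := @engel _ L R _ _ _ h 0%VS B.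
- by move=> x y xR yR; exact: idR.
- move=> x y /nilR[k kx]; exists (p ^ k)%N.
  by rewrite -(iter_pmap L_env) kx lie0l.
- by move=> x v _; rewrite !memv0 => /eqP->; rewrite linear0.
- by move=> x v _; exact: sB.
- by apply: contra f0 => /subvP/(_ f fB); rewrite memv0.
- move=> x v /nilR[k kx] vB; exists (p ^ k)%N.
  by rewrite iterB // kx linear0 zero_lfunE mem0v.
exists e; split=> //; first by rewrite -memv0.
by move=> x /Re; rewrite memv0 => /eqP.
Qed.

(** The submodule [D] of T + Hom(V, W) generated by (t, e) maps injectively to [T], so it is split;
    its second component, evaluated on [V], exhibits [W] as a bilinear image. *)
Lemma transfer_split (M0 : vectType F) (m0 : M0) (f : 'Hom(V, W)) :
  m0 != 0 -> adm (trivrep L M0) -> f != 0 ->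
  (forall x v, f (pdefect p pmap rV x v) = pdefect p pmap rW x (f v)) ->
  irreducible (pullrep jM rW) ->
  FF (semidirect (pullrep jM rV)) -> FF (semidirect (pullrep jM rW)).
Proof.
move=> m00 a0 f0 fP W_irr FFV.
have [R [Radm admR idR nilR]] := admissible_kernel.
have [B [BP sB rB]] := intertwiner_space.
have fB : f \in B by apply/BP.
have [e [eB e0 Re]] := restricted_invariant sB rB idR nilR fB f0.
have [n [xs [Y [cY Y0 Yx Yspan]]]] := dual_coefficients FF_form m00 a0.
have cunit := coefficient_unit m00 a0.
pose wm (a : {ffun 'I_n -> 'I_p}) := wmon Y (box_word a).
have cw a : coefficient FF L_env (wm a).
  rewrite /wm; elim: (box_word a) => //= i w IHw.
  exact: (coefficient_shuffle charF FF_form FF_sat).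
have [T [rT [t [aT tP]]]] :=
  coefficient_common FF_form (enum {ffun 'I_n -> 'I_p}) (ex_intro _ _ cunit) cw.
pose rO := sumrep rT h; pose om : T * 'Hom(V, W) := (t, e).
(* On [G] the action is restricted and [R] acts as zero, so PBW straightening applies. *)
pose G (u : T * 'Hom(V, W)) := u.2 \in B /\ forall x, x \in R -> h x u.2 = 0.
have Gs x u : G u -> G (rO x u).
  rewrite /G sumrepE /= => -[uB uR]; split; first exact: sB.
  move=> y yR; have /eqP := lrepP h y x u.2.
  rewrite (uR y yR) linear0 subr0 uR; last by rewrite lieC memvN idR.
  by move=> /eqP <-.
have Gr x u : G u -> iter p (rO x) u = rO (pmap x) u.
  by move=> [uB _]; rewrite iter_sumrep sumrepE rB //; case: aT => ->.
have Gspan x : exists c : 'I_n -> F, forall u, G u ->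
    rO x u = \sum_i c i *: rO (xs i) u.
  have [c cP] := Yspan x; exists c => u [uB uR].
  have xR : x - \sum_i c i *: xs i \in R by apply: admR; exact: cP.
  have : rO (x - \sum_i c i *: xs i) u = 0.
    by rewrite sumrepE uR // (Radm _ _ _ aT xR) zero_lfunE.
  rewrite linearB linear_sum add_lfunE opp_lfunE sum_lfunE /= => /eqP.
  rewrite subr_eq0 => /eqP ->; apply: eq_bigr => i _.
  by rewrite linearZ scale_lfunE.
have Gom : G om by split.
have Gw w : G (wact rO w om).
  elim/last_ind: w => [|w x IHw] //.
  by rewrite -cats1 wact_cat; exact: Gs.
pose ow (a : {ffun 'I_n -> 'I_p}) := wact rO (map xs (box_word a)) om.
have [||D DP] := @vspace_of_pred _ (T * 'Hom(V, W))%type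
    (fun d => exists c : {ffun 'I_n -> 'I_p} -> F, d = \sum_a c a *: ow a).
- by exists (fun=> 0); rewrite big1 // => a _; rewrite scale0r.
- move=> k _ _ [c ->] [c' ->]; exists (fun a => k * c a + c' a).
  rewrite scaler_sumr -big_split; apply: eq_bigr => a _.
  by rewrite scalerDl scalerA.
have Dw w : wact rO (map xs w) om \in D.
  apply: (pbw_span charF Gs Gr Gspan Gom) => a; apply/DP.
  exists (fun b => (b == a)%:R); rewrite (bigD1 a) //= eqxx scale1r big1 ?addr0 // => b ba.
  by rewrite (negbTE ba) scale0r.
have omD : om \in D by exact: (Dw [::]).
have sD x d : d \in D -> rO x d \in D.
  move=> /DP[c ->]; rewrite linear_sum rpred_sum // => a _; rewrite linearZ rpredZ //=.
  have [k kE] := Gspan x; rewrite kE; last exact: Gw.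
  rewrite rpred_sum // => i _; rewrite rpredZ //.
  have := Dw (rcons (box_word a) i); rewrite -cats1 map_cat wact_cat.
  exact.
(* The first components of the monomials spanning [D] are linearly independent. *)
have Dinj d : d \in D -> d.1 = 0 -> d = 0.
  move=> /DP[c ->] s0.
  have c0 : forall a, c a = 0.
    apply: (box_word_independent Y0 Yx charF (rho := rT) (m := t)).
      by move=> a; apply: tP; rewrite mem_enum.
    rewrite -[RHS]s0 (big_morph (fun u : T * 'Hom(V, W) => u.1) (id1 := 0) (op1 := +%R)) //.
    by apply: eq_bigr => a _; rewrite /ow wact_sumrep.
  by rewrite big1 // => a _; rewrite c0 scale0r.
pose D' : submod rO := Submod sD.
pose sgD := pullrep jM (subrep D').
have sgDE s u : vsval (sgD s u) = rO (j s) (vsval u) by rewrite pullrepE subrepE.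
have FFD : FF (semidirect sgD).
  (* The injection into [T] makes [D] an abelian ideal of the split extension of [T]. *)
  pose i (u : subvs_of D') : semidirect (pullrep jM rT) := ((vsval u).1, 0).
  apply: (@FF_split_abelian_ideal _ _ FF_form _ _ _ sgD i (fun x => x.2)).
  - move=> a u v; rewrite /i -[RHS]/(_ + _, a *: 0 + 0).
    by rewrite scaler0 addr0.
  - move=> u [u0]; apply: val_inj; apply: Dinj u0; exact: subvsP.
  - exact: sd_snd_linear.
  - by [].
  - exact: sd_snd_surj.
  - move=> x u; rewrite sd_lieE /i /= (linear0 (pullrep jM rT)) zero_lfunE subr0 linear0.
    by rewrite sgDE sumrepE pullrepE.
  - by move=> u u'; rewrite /i /= linear0 zero_lfunE.
  by apply: (FF_split_eq FF_form _ (proj2 aT)) => s v; rewrite !pullrepE.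
pose b (u : subvs_of D') (v : V) : W := (vsval u).2 v.
apply: (FF_split_bilinear FF_form FF_sat (b := b)) FFD FFV.
- by move=> v a u u'; rewrite /b -scale_lfunE -add_lfunE.
- by move=> u; exact: linearP.
- move=> s u v; rewrite /b sgDE sumrepE /= homrepE !(pullrepE jM).
  by rewrite subrK.
move=> U bU.
(* [U'] is the span of the values of b: a submodule, nonzero because b at (t, e) is e. *)
have [||U' U'P] := @vspace_of_pred _ W
    (fun w => forall U2 : {vspace W}, (forall u v, b u v \in U2) -> w \in U2).
- by move=> U2 _; exact: mem0v.
- by move=> a w w' wP w'P U2 bU2; rewrite memvD ?memvZ ?wP ?w'P.
have [|U'0|U'f] := irreducible_stable W_irr (U := U').
- move=> s w /U'P wP; apply/U'P => U2 bU2; rewrite memv_preim; apply: wP => u v.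
  rewrite -memv_preim.
  have -> : pullrep jM rW s (b u v) = b (sgD s u) v + b u (rV (j s) v).
    by rewrite /b sgDE sumrepE /= homrepE (pullrepE jM) subrK.
  by rewrite memvD ?bU2.
- case/eqP: e0; apply/lfunP => v; rewrite zero_lfunE; apply/eqP.
  rewrite -memv0 -U'0; apply/U'P => U2 bU2.
  have := bU2 (Subvs omD) v; exact.
apply/eqP; rewrite eqEsubv subvf -U'f; apply/subvP => w /U'P; exact.
Qed.

End Modules.
End Transfer.

(** * From clusters to centrality *)

Lemma irreducible_ext (F : fieldType) (S L : lieType F) (j : 'Hom(S, L)) (V : vectType F)
    (rho : lieRep S V) (rhoL : lieRep L V) :
  extends j rho rhoL -> irreducible rho -> irreducible rhoL.
Proof.
move=> ext [V0 irr]; split=> // U.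
have sU s v : v \in U -> rho s v \in U by move=> vU; rewrite -ext submodP.
exact: (irr (Submod sU)).
Qed.

Lemma irreducible_eq (F : fieldType) (S : lieType F) (V : vectType F) (rho sigma : lieRep S V) :
  (forall s v, rho s v = sigma s v) -> irreducible rho -> irreducible sigma.
Proof.
move=> e [V0 irr]; split=> // U.
have sU s v : v \in U -> rho s v \in U by move=> vU; rewrite e submodP.
exact: (irr (Submod sU)).
Qed.

Lemma central_transfer (F : fieldType) (p : nat) (charF : p \in [pchar F])
  (E : fieldType) (iota : {rmorphism F -> E})
  (FF : lieType F -> Prop) (FF_form : formation FF) (FF_sat : saturated FF)
  (S : lieType F) (S_FF : FF S)
  (L : lieType F) (pmap : L -> L) (j : 'Hom(S, L))
  (L_env : p_envelope p pmap j)
  (L_center : forall z, center L z -> pmap z = 0)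
  (V W : vectType F) (rhoV : lieRep S V) (rhoW : lieRep S W)
  (V_irr : irreducible rhoV) (W_irr : irreducible rhoW)
  (rhoVL : lieRep L V) (V_ext : extends j rhoV rhoVL)
  (rhoWL : lieRep L W) (W_ext : extends j rhoW rhoWL) (c : L -> E) :
  cluster iota p pmap rhoVL c -> cluster iota p pmap rhoWL c ->
  central_mod FF rhoV -> central_mod FF rhoW.
Proof.
move=> [_ [nV [UV [[_ _ cV] [iV /cV[subV irrV] hV]]]]].
move=> [_ [nW [UW [[_ _ cW] [iW /cW[subW irrW] hW]]]]].
have [pmapP jM _ _] := L_env; have [pmap_ad _ _] := pmapP.
have [f [f0 fP]] := common_character_hom charF pmap_ad
  (irreducible_ext V_ext V_irr) (irreducible_ext W_ext W_irr)
  subV (irreducible_facrep_proper irrV) subW (irreducible_facrep_proper irrW)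
  (fun x => has_character_scalar_on x hV) (fun x => has_character_scalar_on x hW).
move=> /(FF_split_ext FF_form rhoV S_FF) FFV; apply/(FF_split_ext FF_form rhoW S_FF).
have [v v0] := irreducible_nz V_irr.
(* The extension of [V] by [S] is a nonzero member of the class and so supplies a nonzero trivial
   admissible module. *)
have k0 : ((v, 0) : semidirect rhoV) != 0 by apply: contra_neq v0 => -[].
have [M0 [m0 [m00 a0]]] := admissible_triv charF FF_form S_FF L_env FFV k0.
have eV s u : rhoV s u = pullrep jM rhoVL s u by rewrite pullrepE V_ext.
have eW s u : rhoW s u = pullrep jM rhoWL s u by rewrite pullrepE W_ext.
apply: (FF_split_eq FF_form (rho := pullrep jM rhoWL)) => [s u|]; first by rewrite eW.
apply: (transfer_split charF FF_form FF_sat S_FF L_center m00 a0 f0 fP).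
  exact: irreducible_eq eW W_irr.
exact: (FF_split_eq FF_form eV FFV).
Qed.

Theorem theorem5p1 (F : fieldType) (p : nat) (charF : p \in [pchar F])
  (Fbar : closedFieldType) (iota : {rmorphism F -> Fbar})
  (Fbar_alg : forall a : Fbar, algebraicOver iota a)
  (FF : lieType F -> Prop) (FF_form : formation FF) (FF_sat : saturated FF)
  (S : lieType F) (S_FF : FF S)
  (L : lieType F) (pmap : L -> L) (j : 'Hom(S, L))
  (L_env : p_envelope p pmap j)
  (L_center : forall z, center L z -> pmap z = 0)
  (V W : vectType F) (rhoV : lieRep S V) (rhoW : lieRep S W)
  (V_irr : irreducible rhoV) (W_irr : irreducible rhoW)
  (rhoVL : lieRep L V) (V_ext : extends j rhoV rhoVL)
  (rhoWL : lieRep L W) (W_ext : extends j rhoW rhoWL)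
  (eq_Cl : cluster iota p pmap rhoVL = cluster iota p pmap rhoWL) :
  (central_mod FF rhoV /\ central_mod FF rhoW) \/
  (eccentric_mod FF rhoV /\ eccentric_mod FF rhoW).
Proof.
have pmapP : restricted p pmap by case: L_env.
(* A character in the nonempty cluster of [V] is common to both modules, and the transfer works in
   both directions. *)
have [c cV] := cluster_nonempty iota charF pmapP rhoVL (irreducible_nz V_irr).
have cW : cluster iota p pmap rhoWL c by rewrite -eq_Cl.
have VW := central_transfer charF FF_form FF_sat S_FF L_env L_center V_irr W_irr
  V_ext W_ext cV cW.
have WV := central_transfer charF FF_form FF_sat S_FF L_env L_center W_irr V_irr
  W_ext V_ext cW cV.
have [hV|hV] := EM (central_mod FF rhoV); first by left; split=> //; exact: VW.
by right; split=> // hW; apply: hV; exact: WV.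
Qed.
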